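(* For every integer $n\ge 2$ the $(n+7)$-point quadrature formula $$Q_{n+7}[f]=-\frac{5}{12n}\sigma(0)+\frac{3}{2n}\sigma\Big(\frac1{6n}\Big)-\frac{3}{4n}\sigma\Big(\frac1{3n}\Big)+\frac{1}{6n}\sigma\Big(\frac1{2n}\Big)+\frac1n\sum_{k=1}^{n-1}f\Big(\frac kn\Big),\qquad \sigma(x):=f(x)+f(1-x),$$ is positive definite of order $4$, with error constant $$c_4(Q_{n+7})=\frac{1}{720\,n^4}\Big(1-\frac{5}{36\,n}\Big),$$ and the sequence $\{Q_{n+7}\}$ is asymptotically optimal positive definite of order $4$, i.e. $\lim_{n\to\infty}c_4(Q_{n+7})/c^{+}_{n+7,4}=1$.
   Context: An $N$-point quadrature formula is a functional $Q[f]=\sum_{i=1}^{N}a_i f(\tau_i)$ with nodes $0\le\tau_1<\dots<\tau_N\le 1$ and real weights; its remainder is $R[Q;f]=\int_0^1 f(x)\,dx-Q[f]$. $Q$ is positive definite of order $4$, with error constant $c_4(Q)$, if there is a constant $c_4(Q)>0$ such that for every $f\in C^4[0,1]$ there is $\xi\in[0,1]$ with $R[Q;f]=c_4(Q)f^{(4)}(\xi)$. $c^{+}_{N,4}$ denotes the infimum of $c_4(Q)$ over all $N$-point positive definite quadrature formulae $Q$ of order $4$. *)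

(* Defs.v *)
(* Stdlib reals with Coquelicot. *)
From Stdlib Require Import Reals.
From Coquelicot Require Import Coquelicot.

Open Scope R_scope.

Definition I01 (x : R) : Prop := 0 <= x <= 1.

(* [f] is in C^4[0,1] with fourth derivative [g].  Derivatives and continuity
   are taken within [0,1], hence one-sided at the endpoints; values outside
   [0,1] play no role.  Since [0,1] has no isolated point, [g] is determined
   by [f] on [0,1]. *)
Definition C4_01 (f g : R -> R) : Prop :=
  exists f1 f2 f3 : R -> R,
    (forall x, I01 x -> D_in f f1 I01 x) /\
    (forall x, I01 x -> D_in f1 f2 I01 x) /\
    (forall x, I01 x -> D_in f2 f3 I01 x) /\
    (forall x, I01 x -> D_in f3 g I01 x) /\
    (forall x, I01 x -> continue_in g I01 x).

Definition functional : Type := (R -> R) -> R.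

(* Nodes and weights are numbered from 1 to [N]. *)
Definition quadrature (N : nat) (Q : functional) : Prop :=
  exists a tau : nat -> R,
    (forall i, (1 <= i <= N)%nat -> I01 (tau i)) /\
    (forall i j, (1 <= i)%nat -> (i < j)%nat -> (j <= N)%nat ->
       tau i < tau j) /\
    (forall f, Q f = sum_n_m (fun i => a i * f (tau i)) 1 N).

Definition remainder (Q : functional) (f : R -> R) : R := RInt f 0 1 - Q f.

(* [c] is the error constant of [Q]; it is unique, as the choice
   f = x^4 shows. *)
Definition positive_definite4 (Q : functional) (c : R) : Prop :=
  0 < c /\
  forall f g : R -> R, C4_01 f g ->
    exists xi, I01 xi /\ remainder Q f = c * g xi.

(* The set is bounded below by 0; [real] would only be a default value if no
   [N]-point positive definite formula existed. *)
Definition c_plus4 (N : nat) : R :=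
  real (Glb_Rbar (fun c =>
    exists Q, quadrature N Q /\ positive_definite4 Q c)).

(* [Q n] is an [N n]-point formula; [c n] is its (unique) error constant. *)
Definition asymptotically_optimal4 (N : nat -> nat) (Q : nat -> functional)
  : Prop :=
  exists c : nat -> R,
    eventually (fun n =>
      quadrature (N n) (Q n) /\ positive_definite4 (Q n) (c n)) /\
    is_lim_seq (fun n => c n / c_plus4 (N n)) 1.

Definition sigma (f : R -> R) (x : R) : R := f x + f (1 - x).

Definition Qn7 (n : nat) : functional := fun f =>
  - (5 / (12 * INR n)) * sigma f 0
  + 3 / (2 * INR n) * sigma f (1 / (6 * INR n))
  - 3 / (4 * INR n) * sigma f (1 / (3 * INR n))
  + 1 / (6 * INR n) * sigma f (1 / (2 * INR n))
  + 1 / INR n * sum_n_m (fun k => f (INR k / INR n)) 1 (n - 1).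

(* Main.v *)
Require Import Defs.
From Stdlib Require Import Reals Factorial Lra Lia Psatz.
From Coquelicot Require Import Coquelicot.
Open Scope R_scope.

(** Lower bound for an arbitrary positive definite formula with [N] nodes. Its
    Peano kernel [K] is nonnegative and C^2, vanishes at 0 and 1, and between
    consecutive nodes it is [t^4/24] plus a cubic. Rescale lengths by
    [n = N + 1] and let [q] be the kernel on a piece of length [h], with end
    values [3 r0^2], [3 r1^2] and outward end slopes [w0], [w1]. Then
      [720 * integral of q = h^5 + 1080 h (r0^2 + r1^2) - 60 h^2 (w0 + w1)].
    If the slopes vanish, this is at least [h^5 >= 5 h - 4]. In general one adds
    [60 (M0 + M1)], where [M] is the outward slope clamped to [[-b, b]] with
    [b = min (r, 1/48)]. As [M] is odd in the slope, these terms cancel at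
    each node, and the nonnegativity of [q] at one or two well chosen points
    shows that each corrected piece is still at least [5 h - 4]. Summing over
    the [N + 1] pieces gives [720 n^5 c >= 5 n - 4 n], i.e.
    [c >= 1 / (720 (N + 1)^4)].

    For the explicit formula the kernel is [u^2 (h - u)^2 / 24] on the inner
    cells and a nonnegative spline on the two end cells. Integration by parts
    on each piece bounds the remainder by the extreme values of [f''''] times
    the error constant, and the intermediate value theorem concludes. *)

(** * Polynomial inequalities *)

(** Convexity: the tangent of [h ^ 5] at [a] lies below the curve. In the uses below, [a] is
    typically a rational number near the minimiser of the polynomial at hand, which makes the
    inequality affine in [h]. *)
Lemma pow5_tangent (a h : R) : 0 <= a -> 0 <= h -> 5 * a ^ 4 * h - 4 * a ^ 5 <= h ^ 5.
Proof.
intros Ha Hh.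
assert (E : h ^ 5 - (5 * a ^ 4 * h - 4 * a ^ 5)
  = (h - a) ^ 2 * (h ^ 3 + 2 * a * h ^ 2 + 3 * a ^ 2 * h + 4 * a ^ 3)) by ring.
assert (0 <= h ^ 3) by (apply pow_le; lra).
assert (0 <= a ^ 3) by (apply pow_le; lra).
assert (0 <= a * h ^ 2) by (apply Rmult_le_pos; nra).
assert (0 <= a ^ 2 * h) by (apply Rmult_le_pos; nra).
assert (0 <= (h - a) ^ 2 * (h ^ 3 + 2 * a * h ^ 2 + 3 * a ^ 2 * h + 4 * a ^ 3)).
{ apply Rmult_le_pos; [apply pow2_ge_0 | lra]. }
lra.
Qed.

(** The gain [h ^ 5 - 5 * h + 4] equals [(h - 1) ^ 2 * (h ^ 3 + 2 * h ^ 2 + 3 * h + 4)], and half of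
    it is spent at each end of a piece. After multiplication by [h], completing the square in [m]
    leaves a multiple of the same factor [(h - 1) ^ 2]. *)
Lemma end_defect_long_ge0 h m : 1 <= h ->
  0 <= 1080 * h * m ^ 2 - 60 * (h ^ 2 - 1) * m + (h ^ 5 - 5 * h + 4) / 2.
Proof.
intros Hh.
assert (0 <= h * (1080 * h * m ^ 2 - 60 * (h ^ 2 - 1) * m + (h ^ 5 - 5 * h + 4) / 2)).
{ replace (h * _) with (1080 * (h * m - (h ^ 2 - 1) / 36) ^ 2 + (h - 1) ^ 2 *
   (h * (h ^ 3 + 2 * h ^ 2 + 3 * h + 4) / 2 - 5 / 6 * (h + 1) ^ 2)) by field.
  assert (0 <= (h * m - (h ^ 2 - 1) / 36) ^ 2) by apply pow2_ge_0.
  assert (0 <= h * (h ^ 3 + 2 * h ^ 2 + 3 * h + 4) / 2 - 5 / 6 * (h + 1) ^ 2).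
  { replace h with (1 + (h - 1)) by ring. set (u := h - 1). assert (0 <= u) by (unfold u; lra).
    nra. }
  assert (0 <= (h - 1) ^ 2) by apply pow2_ge_0. nra. }
nra.
Qed.

Lemma end_defect_short_ge0 h m : 0 <= h <= 1 -> 0 <= m <= 1 / 48 ->
  0 <= 1080 * h * m ^ 2 - 60 * (1 - h ^ 2) * m + (h ^ 5 - 5 * h + 4) / 2.
Proof.
intros Hh Hm.
(* Above 13/20 the completed square suffices for every [m]. Below, [m ^ 2] is replaced by its
   tangent at 1/48, and the resulting affine function of [m] is nonnegative at 0 and at 1/48. *)
destruct (Rle_dec h (13/20)).
- assert (H1 := pow5_tangent (3/5) h ltac:(lra) ltac:(lra)).
  assert (H2 : 0 <= h * (m - 1 / 48) ^ 2).
  { apply Rmult_le_pos; [lra | apply pow2_ge_0]. }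
  assert (H3 : 0 <= (1 - 48 * m) * ((h ^ 5 - 5 * h + 4) / 2 - 15 / 32 * h)).
  { apply Rmult_le_pos; [lra | nra]. }
  assert (H4 : 0 <= (48 * m) * ((h ^ 5 - 5 * h + 4) / 2 + 15 / 32 * h - 5 / 4 * (1 - h ^ 2))).
  { apply Rmult_le_pos; [lra | nra]. }
  nra.
- assert (0 <= h * (1080 * h * m ^ 2 - 60 * (1 - h ^ 2) * m + (h ^ 5 - 5 * h + 4) / 2)).
  { replace (h * _) with (1080 * (h * m - (1 - h ^ 2) / 36) ^ 2 + (h - 1) ^ 2 *
     (h * (h ^ 3 + 2 * h ^ 2 + 3 * h + 4) / 2 - 5 / 6 * (h + 1) ^ 2)) by field.
    assert (0 <= (h * m - (1 - h ^ 2) / 36) ^ 2) by apply pow2_ge_0.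
    assert (0 <= h * (h ^ 3 + 2 * h ^ 2 + 3 * h + 4) / 2 - 5 / 6 * (h + 1) ^ 2).
    { replace h with (13/20 + (h - 13/20)) by ring. set (u := h - 13/20). assert (0 <= u)
      by (unfold u; lra).
      nra. }
    assert (0 <= (h - 1) ^ 2) by apply pow2_ge_0. nra. }
  nra.
Qed.

(** What remains when one end is capped and [node_bound_quarter] is inserted: 3/8 = 1 - 5/8, 880 =
    1080 - 200 and 21/4 = 4 + 60/48. Without the square the expression is affine in [m], so its
    values at 0 and 1/48 decide. *)
Lemma cap_neg_ends_ge0 h m : 0 <= h -> 0 <= m <= 1 / 48 ->
  0 <= 3 / 8 * h ^ 5 - 5 * h + 21 / 4 + 880 * h * m ^ 2 - 60 * m + 40 * h ^ 2 * m.
Proof.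
intros Hh Hm.
assert (Ha := pow5_tangent (32/25) h ltac:(lra) Hh).
assert (Hb := pow5_tangent (113/100) h ltac:(lra) Hh).
assert (H2 : 0 <= h * m ^ 2).
{ apply Rmult_le_pos; [lra | apply pow2_ge_0]. }
assert (H3 : 0 <= (1 - 48 * m) * (3 / 8 * h ^ 5 - 5 * h + 21 / 4)).
{ apply Rmult_le_pos; nra. }
assert (H4 : 0 <= (48 * m) * (3 / 8 * h ^ 5 - 5 * h + 4 + 5 / 6 * h ^ 2)).
{ apply Rmult_le_pos; nra. }
nra.
Qed.

(** Companion of [cap_neg_ends_ge0] for an end of type [end_lin]. The square is now needed and
    enters through its tangent at 1/96. *)
Lemma cap_lin_ends_ge0 h m : 0 <= h -> 0 <= m <= 1 / 48 ->
  0 <= 3 / 8 * h ^ 5 - 5 * h + 21 / 4 + 880 * h * m ^ 2 + 60 * m - 40 * h ^ 2 * m.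
Proof.
intros Hh Hm.
assert (Ha := pow5_tangent (321/250) h ltac:(lra) Hh).
assert (Hb := pow5_tangent (139/100) h ltac:(lra) Hh).
(* The tangent of the cube at 139/100, times [h ^ 2]: a cubic minorant of [h ^ 5], used against the
   quadratic term in [H4]. *)
assert (Hc : h ^ 2 * (3 * (139/100)^2 * h - 2 * (139/100) ^ 3) <= h ^ 5).
{ assert (0 <= h ^ 2 * ((h - 139/100) ^ 2 * (h + 2 * (139/100)))).
  { apply Rmult_le_pos; [apply pow2_ge_0 | apply Rmult_le_pos; [apply pow2_ge_0 | lra]]. }
  nra. }
assert (H2 : 0 <= h * (m - 1 / 96) ^ 2).
{ apply Rmult_le_pos; [lra | apply pow2_ge_0]. }
assert (H3 : 0 <= (1 - 48 * m) * (3 / 8 * h ^ 5 - 5 * h + 21 / 4 - 880 / 9216 * h)).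
{ apply Rmult_le_pos; nra. }
assert (H4 : 0 <= (48 * m) * (3 / 8 * h ^ 5 - 5 * h + 21 / 4 + 880 / 48 ^ 2 * (3 / 4) * h + 5 / 4
  - 5 / 6 * h ^ 2)).
{ apply Rmult_le_pos; [lra|]. 
  assert (0 <= h * (h - 139 / 100) ^ 2) by (apply Rmult_le_pos; [lra | apply pow2_ge_0]).
  assert (0 <= (h - 139 / 100) ^ 2) by apply pow2_ge_0.
  destruct (Rle_dec h 2); [clear Ha Hb H2 H3; nra | clear Ha Hb H2 H3; nra]. }
nra.
Qed.

(** Here 31/196 = 1 - 165/196 and 13/2 = 4 + 2 * 60/48 are what the two test points of
    [excess_cap_cap] leave. The tangent point approximates the minimiser, whose fourth power is
    196/31. *)
Lemma cap_cap_ends_ge0 h : 0 <= h -> 0 <= 31 / 196 * h ^ 5 - 5 * h + 13 / 2.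
Proof.
intros Hh. assert (H := pow5_tangent (793/500) h ltac:(lra) Hh). nra.
Qed.

Lemma quintic_ge0 h : 0 <= h -> 0 <= h ^ 5 - 5 * h + 4.
Proof. intros Hh. assert (H := pow5_tangent 1 h ltac:(lra) Hh). lra. Qed.

(** The coefficient 1080 is lowered because a test point near a steep opposite end may cost up to
    180 * 9/20 = 81 times [h * r ^ 2]. *)
Lemma end_defect_weak_ge0 h m : 0 <= h -> 0 <= m ->
  0 <= 990 * h * m ^ 2 - 60 * (h ^ 2 - 1) * m + (h ^ 5 - 5 * h + 4) / 2.
Proof.
intros Hh Hm. assert (Hs := quintic_ge0 h Hh).
destruct (Rle_dec h 1) as [H1|H1].
{ assert (0 <= h * m ^ 2) by (apply Rmult_le_pos; [lra | apply pow2_ge_0]).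
  assert (0 <= (1 - h ^ 2) * m) by (apply Rmult_le_pos; nra). lra. }
assert (0 <= h * (990 * h * m ^ 2 - 60 * (h ^ 2 - 1) * m + (h ^ 5 - 5 * h + 4) / 2)).
{ replace (h * _) with (990 * (h * m - (h ^ 2 - 1) / 33) ^ 2 + (h - 1) ^ 2 *
   (h * (h ^ 3 + 2 * h ^ 2 + 3 * h + 4) / 2 - 10 / 11 * (h + 1) ^ 2)) by field.
  assert (0 <= (h * m - (h ^ 2 - 1) / 33) ^ 2) by apply pow2_ge_0.
  assert (0 <= h * (h ^ 3 + 2 * h ^ 2 + 3 * h + 4) / 2 - 10 / 11 * (h + 1) ^ 2).
  { replace h with (1 + (h - 1)) by ring. set (u := h - 1). assert (0 <= u) by (unfold u; lra).
    nra. }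
  assert (0 <= (h - 1) ^ 2) by apply pow2_ge_0. nra. }
nra.
Qed.

(** The share of an end of type [end_sqrt] after [node_bound_sqrt] has been applied: 639 = 1080 -
    360 - 81. *)
Lemma sqrt_end_ge0 h t : 0 <= h -> 0 <= t <= 1 / 48 ->
  0 <= (h ^ 5 - 5 * h + 4) / 2 + (60 - 30 * h - 15 * h ^ 5) * t + 639 * h * t ^ 2.
Proof.
intros Hh Ht. assert (Hs := quintic_ge0 h Hh).
assert (Hq : forall a, 0 <= h * (t - a) ^ 2) by (intros a; apply Rmult_le_pos;
  [lra | apply pow2_ge_0]).
destruct (Rle_dec h (11/10)) as [H1|H1].
{ assert (H5 : h ^ 5 <= (11/10) ^ 5) by (apply pow_incr; lra).
  specialize (Hq 0).
  assert (0 <= (60 - 30 * h - 15 * h ^ 5) * t) by (apply Rmult_le_pos; lra). nra. }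
assert (Ha := pow5_tangent (11/10) h ltac:(lra) Hh).
assert (Hb := pow5_tangent (6/5) h ltac:(lra) Hh).
assert (Hc := pow5_tangent (133/100) h ltac:(lra) Hh).
assert (Hd := pow5_tangent (129/100) h ltac:(lra) Hh).
(* In both ranges a tangent of [t ^ 2], at 1/144 or at 1/48, leaves an affine function of [t], which
   is tested at 0 and 1/48. *)
destruct (Rle_dec h (31/25)) as [H2|H2].
- specialize (Hq (1/144)).
  assert (H3 : 0 <= (1 - 48 * t) * ((h ^ 5 - 5 * h + 4) / 2 - 639 / 20736 * h)).
  { apply Rmult_le_pos; lra. }
  assert (H4 : 0 <= (48 * t) * ((h ^ 5 - 5 * h + 4) / 2 + (60 - 30 * h - 15 * h ^ 5) / 48 + 639 *
    5 / 20736 * h)).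
  { apply Rmult_le_pos; lra. }
  nra.
- specialize (Hq (1/48)).
  assert (H3 : 0 <= (1 - 48 * t) * ((h ^ 5 - 5 * h + 4) / 2 - 639 / 2304 * h)).
  { apply Rmult_le_pos; lra. }
  assert (H4 : 0 <= (48 * t) * ((h ^ 5 - 5 * h + 4) / 2 + (60 - 30 * h - 15 * h ^ 5) / 48 + 639 /
    2304 * h)).
  { apply Rmult_le_pos; lra. }
  nra.
Qed.

(** The mixed term arises because the test point near the steep end reduces the weight of the other
    slope from 1 to [1 - rho], with [rho <= 7 * t]. *)
Lemma sqrt_neg_ends_ge0 h t m : 0 <= h -> 0 <= t <= 1 / 48 -> 0 <= m <= 1 / 48 ->
  0 <= h ^ 5 - 5 * h + 4 + (60 - 30 * h - 15 * h ^ 5) * t + 720 * h * t ^ 2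
     + 990 * h * m ^ 2 - 60 * (1 - h ^ 2 * (1 - 7 * t)) * m.
Proof.
intros Hh Ht Hm. assert (Hs := quintic_ge0 h Hh).
destruct (Rle_dec h 1) as [H1|H1].
- assert (H5 : h ^ 5 <= 1 ^ 5) by (apply pow_incr; lra).
  assert (0 <= (45 - 30 * h - 15 * h ^ 5) * t) by (apply Rmult_le_pos; lra).
  assert (0 <= h * t ^ 2) by (apply Rmult_le_pos; [lra | apply pow2_ge_0]).
  assert (h ^ 2 * (t * m) <= 1 / 48 * t).
  { assert (0 <= t * m <= t * (1 / 48)) by (split;
    [apply Rmult_le_pos | apply Rmult_le_compat_l]; lra).
    assert (0 <= (1 - h ^ 2) * (t * m)) by (apply Rmult_le_pos; nra). lra. }
  assert (0 <= h ^ 5 - 5 * h + 4 + 990 * h * m ^ 2 - 60 * (1 - h ^ 2) * m).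
  { destruct (Rle_dec h (1/2)).
    - assert (Ha := pow5_tangent (1/2) h ltac:(lra) Hh).
      assert (0 <= h * m ^ 2) by (apply Rmult_le_pos; [lra | apply pow2_ge_0]).
      nra.
    - assert (0 <= h * (990 * h * m ^ 2 - 60 * (1 - h ^ 2) * m + (h ^ 5 - 5 * h + 4))).
      { replace (h * _) with (990 * (h * m - (1 - h ^ 2) / 33) ^ 2 + (h - 1) ^ 2 *
         (h * (h ^ 3 + 2 * h ^ 2 + 3 * h + 4) - 10 / 11 * (h + 1) ^ 2)) by field.
        assert (0 <= (h * m - (1 - h ^ 2) / 33) ^ 2) by apply pow2_ge_0.
        assert (0 <= h * (h ^ 3 + 2 * h ^ 2 + 3 * h + 4) - 10 / 11 * (h + 1) ^ 2).
        { replace h with (1/2 + (h - 1/2)) by ring. set (u := h - 1/2). assert (0 <= u)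
          by (unfold u; lra).
          nra. }
        assert (0 <= (h - 1) ^ 2) by apply pow2_ge_0. nra. }
      nra. }
  nra.
- assert (Hq := sqrt_end_ge0 h t Hh Ht).
  assert (H2 : 0 <= (h ^ 2 - 1) * ((1 - 7 * t) * m)).
  { apply Rmult_le_pos; [nra | apply Rmult_le_pos; lra]. }
  (* The surplus 81 = 720 - 639 pays for the mixed term, since 420 = 2 * 9 * 70/3 and the square of
     70/3 is below 990. *)
  assert (H3 : 0 <= h * (81 * t ^ 2 + 990 * m ^ 2) - 420 * t * m).
  { assert (0 <= (h - 1) * (81 * t ^ 2 + 990 * m ^ 2)) by (apply Rmult_le_pos; nra).
    assert (0 <= (9 * t - 70 / 3 * m) ^ 2) by apply pow2_ge_0. nra. }
  nra.
Qed.

(** The combination formed in [excess_sqrt_cap], where [rho = d / (1 - d)] at [d = 6 * t]. The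
    bounds [A1] and [A2] eliminate [rho]; a tangent of [t ^ 2] at 1/96 then makes the expression
    affine in [t]. *)
Lemma cap_sqrt_ends_ge0 h t rho : 0 <= h -> 0 <= t <= 1 / 48 -> rho * (1 - 6 * t) = 6 * t ->
  0 <= rho <= 1/7 ->
  0 <= h ^ 5 - 5 * h + 21/4 + 60 * t - 5/2 * h ^ 5 * ((1 - rho / 2) / 4 + (2/3 + rho / 6) * (6 * t))
   + 1080 * h * t ^ 2 - 30 * h * t * (2/3 + rho/6) * (1 + 12 * t) - 200 * h * t ^ 2 * (1 - rho/2).
Proof.
intros Hh Ht Hr Hr2.
assert (H5 : 0 <= h ^ 5) by (apply pow_le; lra).
assert (R1 : 6 * t <= rho) by nra.
assert (R2 : rho <= 48/7 * t) by nra.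
assert (A1 : 5/2 * ((1 - rho / 2) / 4 + (2/3 + rho / 6) * (6 * t)) <= 5/8 + 87/10 * t) by nra.
assert (A2 : 600 * t ^ 2 - 21 * t
   <= 1080 * t ^ 2 - 30 * t * (2/3 + rho/6) * (1 + 12 * t) - 200 * t ^ 2 * (1 - rho/2)).
{ assert (0 <= t * (280 * t + 1 - 5 * rho * (1 + 12 * t) - 240 * t + 100 * t * rho)).
  { apply Rmult_le_pos; nra. }
  nra. }
assert (Ha := pow5_tangent (1283/1000) h ltac:(lra) Hh).
assert (Hb := pow5_tangent (763/500) h ltac:(lra) Hh).
assert (B1 := Rmult_le_compat_l _ _ _ H5 A1).
assert (B2 := Rmult_le_compat_l _ _ _ Hh A2).
assert (Hq : 0 <= h * (t - 1/96) ^ 2) by (apply Rmult_le_pos; [lra | apply pow2_ge_0]).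
assert (H3 : 0 <= (1 - 48 * t) * (3/8 * h ^ 5 - 5 * h + 21/4 - 600/9216 * h)).
{ apply Rmult_le_pos; lra. }
assert (H4 : 0 <= (48 * t) * (31/160 * h ^ 5 - 5 * h + 13/2 + (1800/9216 - 21/48) * h)).
{ apply Rmult_le_pos; lra. }
nra.
Qed.

(** * The inequality for one piece of the kernel *)

(* The potential that compensates the slopes at a node where the kernel has
   value [3 r^2] and slope [w]. The cap [1/48] keeps it below the gain 4 of a
   very short piece; any cap near this value would do. *)
Definition clamp_slope (r w : R) : R := Rmax (- Rmin r (1 / 48)) (Rmin w (Rmin r (1 / 48))).

Lemma clamp_slope_opp r w : 0 <= r -> clamp_slope r (- w) = - clamp_slope r w.
Proof.
intros Hr. unfold clamp_slope, Rmax, Rmin. repeat destruct Rle_dec; lra.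
Qed.

(** The kernel vanishes at 0 and 1, so this removes the potential at both ends of the interval. *)
Lemma clamp_slope_0 w : clamp_slope 0 w = 0.
Proof. unfold clamp_slope, Rmax, Rmin. repeat destruct Rle_dec; lra. Qed.

(** The regimes of the clamp. In the first two the slope [w] is at most the potential, and the end
    needs no further information; in the last two it exceeds the potential, and nonnegativity of the
    kernel inside the piece has to be used. *)
Inductive end_type (r w : R) : R -> Prop :=
| end_neg m : 0 <= m <= 1 / 48 -> m <= r -> m <= - w -> end_type r w (- m)
| end_lin : 0 <= w <= 1 / 48 -> w <= r -> end_type r w w
| end_sqrt : r <= 1 / 48 -> r < w -> end_type r w r
| end_cap : 1 / 48 <= r -> 1 / 48 < w -> end_type r w (1 / 48).

Lemma end_typeP r w : 0 <= r -> end_type r w (clamp_slope r w).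
Proof.
intros Hr. unfold clamp_slope.
destruct (Rle_dec 0 w) as [Hw|Hw].
- rewrite Rmax_right by (unfold Rmin; repeat destruct Rle_dec; lra).
  destruct (Rle_dec r (1/48)).
  + rewrite (Rmin_left r) by lra. destruct (Rle_dec w r).
    * rewrite Rmin_left by lra. apply end_lin; lra.
    * rewrite Rmin_right by lra. apply end_sqrt; lra.
  + rewrite (Rmin_right r) by lra. destruct (Rle_dec w (1/48)).
    * rewrite Rmin_left by lra. apply end_lin; lra.
    * rewrite Rmin_right by lra. apply end_cap; lra.
- rewrite <- (Ropp_involutive (Rmax _ _)). apply end_neg;
  unfold Rmax, Rmin; repeat destruct Rle_dec; lra.
Qed.

(* [q >= 0] at the point dividing the piece in the ratio [1 - d : d], with [q]
   expressed by its Hermite data at the two ends and solved for [w1]. *)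
Definition node_bound (h r0 w0 r1 w1 : R) : Prop := forall d, 0 < d < 1 ->
  60 * h ^ 2 * (w1 + w0 * (d / (1 - d))) <=
  5 / 2 * h ^ 5 * d + 180 * h * r1 ^ 2 * ((1 + 2 * d) / d)
  + 180 * h * r0 ^ 2 * ((3 - 2 * d) * d / (1 - d) ^ 2).

(* [720 * (integral of q) - (5 h - 4)] corrected by the potentials [m0], [m1]. *)
Definition excess (h r0 w0 m0 r1 w1 m1 : R) : R :=
  h ^ 5 - 5 * h + 4 + 1080 * h * (r0 ^ 2 + r1 ^ 2) - 60 * h ^ 2 * (w0 + w1) + 60 * (m0 + m1).

Lemma excess_sym h r0 w0 m0 r1 w1 m1 :
  excess h r0 w0 m0 r1 w1 m1 = excess h r1 w1 m1 r0 w0 m0.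
Proof. unfold excess. ring. Qed.

(** A nonnegative kernel cannot vanish at an end with positive outward slope: if [r1 = 0], every
    term of [node_bound] except [60 * h ^ 2 * w1] is of order [d], and [d] is taken small. *)
Lemma node_bound_pos h r0 w0 r1 w1 : 0 < h -> 0 <= r1 -> r1 < w1 ->
  node_bound h r0 w0 r1 w1 -> 0 < r1.
Proof.
intros Hh H0 H1 B. destruct H0 as [H0|H0]; [exact H0|]. exfalso. subst r1.
set (C := 5 / 2 * h ^ 5 + 180 * h * r0 ^ 2 * 12 + 120 * h ^ 2 * Rabs w0 + 1).
assert (P5 : 0 < h ^ 5) by (apply pow_lt; lra).
assert (P0 : 0 <= 180 * h * r0 ^ 2) by (apply Rmult_le_pos; [lra | apply pow2_ge_0]).
assert (Pw : 0 <= 60 * h ^ 2 * Rabs w0).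
{ apply Rmult_le_pos; [nra | apply Rabs_pos]. }
assert (HC : 0 < C) by (unfold C; nra).
set (X := 60 * h ^ 2 * w1). assert (HX : 0 < X) by (unfold X; apply Rmult_lt_0_compat; nra).
set (d := Rmin (1/2) (X / (2 * C))).
assert (Hd0 : 0 < d).
{ unfold d. apply Rmin_pos; [lra|]. apply Rdiv_lt_0_compat; lra. }
assert (Hd1 : d <= 1/2) by apply Rmin_l.
assert (Hd2 : d * C <= X / 2).
{ apply Rle_trans with (X / (2 * C) * C).
  - apply Rmult_le_compat_r; [lra | apply Rmin_r].
  - right. field. lra. }
specialize (B d ltac:(lra)).
assert (D1 : 0 <= d / (1 - d) <= 2 * d).
{ split; [apply Rle_mult_inv_pos; lra|].
  apply Rmult_le_reg_r with (1 - d); [lra|]. field_simplify; [nra | lra]. }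
assert (D2 : (3 - 2 * d) * d / (1 - d) ^ 2 <= 12 * d).
{ apply Rmult_le_reg_r with ((1 - d) ^ 2); [nra|].
  replace ((3 - 2 * d) * d / (1 - d) ^ 2 * (1 - d) ^ 2) with ((3 - 2 * d) * d) by (field; lra).
  assert (1/4 <= (1 - d)^2) by nra. nra. }
assert (E1 : - (60 * h ^ 2 * Rabs w0) * (2 * d) <= 60 * h ^ 2 * (w0 * (d / (1 - d)))).
{ assert (- Rabs w0 <= w0) by (unfold Rabs; destruct Rcase_abs; lra).
  assert (0 <= Rabs w0) by apply Rabs_pos.
  assert (- Rabs w0 * (2 * d) <= w0 * (d / (1 - d))) by nra.
  assert (0 <= 60 * h ^ 2) by nra. nra. }
assert (E2 := Rmult_le_compat_l _ _ _ P0 D2).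
unfold C in Hd2. unfold X in *. nra.
Qed.

(** An end whose slope does not exceed its potential consumes at most half of the gain, without any
    interior test point. *)
Lemma excess_nl h r w m : 0 < h -> 0 <= r -> end_type r w m -> w <= m ->
  - (h ^ 5 - 5 * h + 4) / 2 <= 1080 * h * r ^ 2 - 60 * h ^ 2 * w + 60 * m.
Proof.
intros Hh Hr T.
assert (Hs := quintic_ge0 h ltac:(lra)).
assert (Hh2 : 0 <= h ^ 2) by apply pow2_ge_0.
destruct T as [m Hm Hmr Hmw|Hw Hwr|Hr' Hw|Hr' Hw]; intros HL; [| |lra|lra].
- assert (h * m ^ 2 <= h * r ^ 2) by (apply Rmult_le_compat_l; [lra|]; apply pow_incr; lra).
  assert (h ^ 2 * m <= h ^ 2 * (- w)) by (apply Rmult_le_compat_l; lra).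
  destruct (Rle_dec h 1).
  + assert (P := end_defect_short_ge0 h m ltac:(lra) Hm). lra.
  + assert (P := end_defect_long_ge0 h m ltac:(lra)). assert (0 <= (h ^ 2 - 1) * m)
    by (apply Rmult_le_pos; nra). lra.
- assert (h * w ^ 2 <= h * r ^ 2) by (apply Rmult_le_compat_l; [lra|]; apply pow_incr; lra).
  destruct (Rle_dec h 1).
  + assert (0 <= (1 - h ^ 2) * w) by (apply Rmult_le_pos; nra).
    assert (0 <= h * w ^ 2) by (apply Rmult_le_pos; [lra | apply pow2_ge_0]). lra.
  + assert (P := end_defect_long_ge0 h w ltac:(lra)). lra.
Qed.

(** The range is that of [d = 6 * t] for [t <= 1 / 48]. *)
Lemma ratio_bound d : 0 < d <= 1 / 8 ->
  0 <= (3 - 2 * d) * d / (1 - d) ^ 2 <= 9 / 20 /\ 0 <= d / (1 - d) <= 7 / 6 * d.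
Proof.
intros Hd. repeat split.
- apply Rle_mult_inv_pos; [apply Rmult_le_pos; lra | nra].
- apply Rmult_le_reg_r with ((1 - d) ^ 2); [nra|].
  replace ((3 - 2 * d) * d / (1 - d) ^ 2 * (1 - d) ^ 2) with ((3 - 2 * d) * d) by (field; lra). nra.
- apply Rle_mult_inv_pos; lra.
- apply Rmult_le_reg_r with (1 - d); [lra|].
  replace (d / (1 - d) * (1 - d)) with d by (field; lra). nra.
Qed.

(* [d = 6 t] is of the order of the relative distance [sqrt 72 * t / h^2] from
   the end to the optimal test point. *)
Lemma node_bound_sqrt h r0 w0 t w1 : 0 < h -> 0 < t <= 1 / 48 ->
  node_bound h r0 w0 t w1 ->
  exists rho sg, 0 <= rho <= 7 * t /\ 0 <= sg <= 9 / 20 /\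
  60 * h ^ 2 * (w1 + w0 * rho) <=
  15 * h ^ 5 * t + 30 * h * t + 360 * h * t ^ 2 + 180 * h * r0 ^ 2 * sg.
Proof.
intros Hh Ht B. specialize (B (6 * t) ltac:(lra)).
destruct (ratio_bound (6 * t) ltac:(lra)) as [R1 R2].
exists (6 * t / (1 - 6 * t)), ((3 - 2 * (6 * t)) * (6 * t) / (1 - 6 * t) ^ 2).
repeat split; try lra.
replace (180 * h * t ^ 2 * ((1 + 2 * (6 * t)) / (6 * t))) with (30 * h * t + 360 * h * t ^ 2) in
  B by (field; lra).
lra.
Qed.

(** Only the steep end needs a test point. The opposite slope enters its bound with weight [rho]: if
    nonnegative it helps, if negative it keeps the favourable weight [1 - rho]. *)
Lemma excess_sqrt_nl h r0 w0 m0 t w1 : 0 < h -> 0 <= r0 -> end_type r0 w0 m0 -> w0 <= m0 ->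
  0 < t <= 1 / 48 -> node_bound h r0 w0 t w1 -> 0 <= excess h r0 w0 m0 t w1 t.
Proof.
intros Hh Hr T HL Ht B.
destruct (node_bound_sqrt h r0 w0 t w1 Hh Ht B) as (rho & sg & Hrho & Hsg & HB).
assert (Hh2 : 0 <= h ^ 2) by apply pow2_ge_0.
assert (Hk : 0 <= h * r0 ^ 2) by (apply Rmult_le_pos; [lra | apply pow2_ge_0]).
assert (Hk2 : h * r0 ^ 2 * sg <= h * r0 ^ 2 * (9 / 20)) by (apply Rmult_le_compat_l; lra).
unfold excess.
destruct T as [m Hm Hmr Hmw|Hw Hwr|Hr' Hw|Hr' Hw]; [| |lra|lra].
- assert (h * m ^ 2 <= h * r0 ^ 2) by (apply Rmult_le_compat_l; [lra|]; apply pow_incr; lra).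
  assert (H1 : (1 - rho) * m <= (1 - rho) * (- w0)) by (apply Rmult_le_compat_l; lra).
  assert (H2 : (1 - 7 * t) * m <= (1 - rho) * m) by (apply Rmult_le_compat_r; lra).
  assert (H3 : h ^ 2 * ((1 - 7 * t) * m) <= h ^ 2 * ((1 - rho) * (- w0)))
    by (apply Rmult_le_compat_l; lra).
  assert (P := sqrt_neg_ends_ge0 h t m ltac:(lra) ltac:(lra) Hm). lra.
- assert (h * w0 ^ 2 <= h * r0 ^ 2) by (apply Rmult_le_compat_l; [lra|]; apply pow_incr; lra).
  assert (H3 : 0 <= h ^ 2 * (rho * w0)) by (apply Rmult_le_pos; [lra | apply Rmult_le_pos; lra]).
  assert (P := sqrt_end_ge0 h t ltac:(lra) ltac:(lra)).
  assert (P2 := end_defect_weak_ge0 h w0 ltac:(lra) ltac:(lra)).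
  assert (0 <= h * t ^ 2) by (apply Rmult_le_pos; [lra | apply pow2_ge_0]). lra.
Qed.

(** Each steep end has its own test point. The opposite slopes enter both bounds with a favourable
    sign, so the excess splits into two instances of [sqrt_end_ge0]. *)
Lemma excess_sqrt_sqrt h t0 w0 t1 w1 : 0 < h -> 0 < t0 <= 1 / 48 -> 0 < t1 <= 1 / 48 ->
  0 <= w0 -> 0 <= w1 -> node_bound h t0 w0 t1 w1 -> node_bound h t1 w1 t0 w0 ->
  0 <= excess h t0 w0 t0 t1 w1 t1.
Proof.
intros Hh H0 H1 W0 W1 B1 B0.
destruct (node_bound_sqrt _ _ _ _ _ Hh H1 B1) as (rho & sg & Hrho & Hsg & HB).
destruct (node_bound_sqrt _ _ _ _ _ Hh H0 B0) as (rho' & sg' & Hrho' & Hsg' & HB').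
assert (Hh2 : 0 <= h ^ 2) by apply pow2_ge_0.
assert (Hk : 0 <= h * t0 ^ 2) by (apply Rmult_le_pos; [lra | apply pow2_ge_0]).
assert (Hk' : 0 <= h * t1 ^ 2) by (apply Rmult_le_pos; [lra | apply pow2_ge_0]).
assert (h * t0 ^ 2 * sg <= h * t0 ^ 2 * (9 / 20)) by (apply Rmult_le_compat_l; lra).
assert (h * t1 ^ 2 * sg' <= h * t1 ^ 2 * (9 / 20)) by (apply Rmult_le_compat_l; lra).
assert (0 <= h ^ 2 * (w0 * rho)) by (apply Rmult_le_pos; [lra | apply Rmult_le_pos; lra]).
assert (0 <= h ^ 2 * (w1 * rho')) by (apply Rmult_le_pos; [lra | apply Rmult_le_pos; lra]).
assert (P0 := sqrt_end_ge0 h t0 ltac:(lra) ltac:(lra)).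
assert (P1 := sqrt_end_ge0 h t1 ltac:(lra) ltac:(lra)).
unfold excess. lra.
Qed.

(** At 1/4 the coefficient of [r1 ^ 2] is exactly the 1080 of [excess], so an arbitrarily large
    value at a capped end cancels. *)
Lemma node_bound_quarter h r0 w0 r1 w1 : node_bound h r0 w0 r1 w1 ->
  60 * h ^ 2 * (w1 + w0 / 3) <= 5 / 8 * h ^ 5 + 1080 * h * r1 ^ 2 + 200 * h * r0 ^ 2.
Proof. intros B. specialize (B (1/4) ltac:(lra)). lra. Qed.

Lemma excess_cap_nl h r0 w0 m0 r1 w1 : 0 < h -> 0 <= r0 -> end_type r0 w0 m0 -> w0 <= m0 ->
  node_bound h r0 w0 r1 w1 -> 0 <= excess h r0 w0 m0 r1 w1 (1 / 48).
Proof.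
intros Hh Hr T HL B. apply node_bound_quarter in B.
assert (Hh2 : 0 <= h ^ 2) by apply pow2_ge_0.
unfold excess.
destruct T as [m Hm Hmr Hmw|Hw Hwr|Hr' Hw|Hr' Hw]; [| |lra|lra].
- assert (h * m ^ 2 <= h * r0 ^ 2) by (apply Rmult_le_compat_l; [lra|]; apply pow_incr; lra).
  assert (h ^ 2 * m <= h ^ 2 * (- w0)) by (apply Rmult_le_compat_l; lra).
  assert (P := cap_neg_ends_ge0 h m ltac:(lra) Hm). lra.
- assert (h * w0 ^ 2 <= h * r0 ^ 2) by (apply Rmult_le_compat_l; [lra|]; apply pow_incr; lra).
  assert (P := cap_lin_ends_ge0 h w0 ltac:(lra) Hw). lra.
Qed.

(* [3/14] is a rational value just above the Gauss node
   [(1 - 1 / sqrt 3) / 2], so that the end values still get weights of the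
   right sign. *)
Lemma excess_cap_cap h r0 w0 r1 w1 : 0 < h ->
  node_bound h r0 w0 r1 w1 -> node_bound h r1 w1 r0 w0 ->
  0 <= excess h r0 w0 (1 / 48) r1 w1 (1 / 48).
Proof.
intros Hh B B'. specialize (B (3/14) ltac:(lra)). specialize (B' (3/14) ltac:(lra)).
assert (P := cap_cap_ends_ge0 h ltac:(lra)).
assert (0 <= h * r0 ^ 2) by (apply Rmult_le_pos; [lra | apply pow2_ge_0]).
assert (0 <= h * r1 ^ 2) by (apply Rmult_le_pos; [lra | apply pow2_ge_0]).
unfold excess. lra.
Qed.

(* The weights [1 - rho / 2] and [2 / 3 + rho / 6] of the two test points make
   the coefficient of [w0] exactly 1. *)
Lemma excess_sqrt_cap h t w0 r1 w1 : 0 < h -> 0 < t <= 1 / 48 ->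
  0 <= w0 -> 0 <= w1 -> node_bound h t w0 r1 w1 -> node_bound h r1 w1 t w0 ->
  0 <= excess h t w0 t r1 w1 (1 / 48).
Proof.
intros Hh Ht W0 W1 B1 B0. apply node_bound_quarter in B1.
specialize (B0 (6 * t) ltac:(lra)).
destruct (ratio_bound (6 * t) ltac:(lra)) as [R1 R2].
set (rho := 6 * t / (1 - 6 * t)) in *.
assert (Erho : rho * (1 - 6 * t) = 6 * t) by (unfold rho; field; lra).
assert (Esg : (3 - 2 * (6 * t)) * (6 * t) / (1 - 6 * t) ^ 2 <= 22 / 7 * rho).
{ replace ((3 - 2 * (6 * t)) * (6 * t) / (1 - 6 * t) ^ 2) with ((3 - 12 * t) / (1 - 6 * t) * rho)
    by (unfold rho; field; lra).
  apply Rmult_le_compat_r; [lra|]. apply Rmult_le_reg_r with (1 - 6 * t); [lra|].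
  replace ((3 - 12 * t) / (1 - 6 * t) * (1 - 6 * t)) with (3 - 12 * t) by (field; lra). lra. }
replace (180 * h * t ^ 2 * ((1 + 2 * (6 * t)) / (6 * t))) with (30 * h * t * (1 + 12 * t)) in B0
  by (field; lra).
assert (Hk : 0 <= h * r1 ^ 2) by (apply Rmult_le_pos; [lra | apply pow2_ge_0]).
assert (K1 := Rmult_le_compat_l _ _ _ Hk Esg).
assert (Hrho : 0 <= rho <= 1/7) by (split; [lra|]; nra).
set (sg := (3 - 2 * (6 * t)) * (6 * t) / (1 - 6 * t) ^ 2) in *.
assert (L1 : 0 <= 1 - rho / 2) by lra.
assert (L0 : 0 <= 2 / 3 + rho / 6) by lra.
assert (C1 := Rmult_le_compat_l _ _ _ L1 B1).
assert (C0 := Rmult_le_compat_l _ _ _ L0 B0).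
assert (K2 := Rmult_le_compat_l _ _ _ L0 K1).
assert (Hh2 : 0 <= h ^ 2) by apply pow2_ge_0.
assert (W : 0 <= h ^ 2 * (w1 * (rho * (1 / 6 + rho / 6)))).
{ apply Rmult_le_pos; [lra|]. apply Rmult_le_pos; [lra|]. apply Rmult_le_pos; lra. }
assert (K3 : 0 <= h * r1 ^ 2 * (rho * (540 - 180 * 22 / 7 * (2 / 3 + rho / 6)))).
{ apply Rmult_le_pos; [lra|]. apply Rmult_le_pos; lra. }
assert (P := cap_sqrt_ends_ge0 h t rho ltac:(lra) ltac:(lra) Erho Hrho).
unfold excess. lra.
Qed.

Lemma excess_ge0 h r0 w0 r1 w1 : 0 < h -> 0 <= r0 -> 0 <= r1 ->
  node_bound h r0 w0 r1 w1 -> node_bound h r1 w1 r0 w0 ->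
  0 <= excess h r0 w0 (clamp_slope r0 w0) r1 w1 (clamp_slope r1 w1).
Proof.
intros Hh H0 H1 B1 B0.
assert (T0 := end_typeP r0 w0 H0). assert (T1 := end_typeP r1 w1 H1).
set (m0 := clamp_slope r0 w0) in *. set (m1 := clamp_slope r1 w1) in *.
destruct (Rle_dec w0 m0) as [L0|L0]; destruct (Rle_dec w1 m1) as [L1|L1].
- assert (E0 := excess_nl h r0 w0 m0 Hh H0 T0 L0).
  assert (E1 := excess_nl h r1 w1 m1 Hh H1 T1 L1). unfold excess. lra.
- destruct T1 as [m Hm Hmr Hmw|Hw Hwr|Hr' Hw|Hr' Hw]; [lra|lra| |].
  (* A zero end value is excluded, so that the ratio [6 * t] lies strictly between 0 and 1. *)
  + apply excess_sqrt_nl; auto. split; [|lra]. eapply node_bound_pos; eauto.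
  + apply excess_cap_nl; auto.
- rewrite excess_sym.
  destruct T0 as [m Hm Hmr Hmw|Hw Hwr|Hr' Hw|Hr' Hw]; [lra|lra| |].
  + apply excess_sqrt_nl; auto. split; [|lra]. eapply node_bound_pos; eauto.
  + apply excess_cap_nl; auto.
- destruct T0 as [m Hm Hmr Hmw|Hw Hwr|Hr' Hw|Hr' Hw]; [lra|lra| |];
  destruct T1 as [m' Hm' Hmr' Hmw'|Hw' Hwr'|Hr1 Hw'|Hr1 Hw']; try lra.
  + apply excess_sqrt_sqrt; auto; try lra; (split; [|lra]); eapply node_bound_pos; eauto.
  + apply excess_sqrt_cap; auto; try lra. split; [|lra]; eapply node_bound_pos; eauto.
  + rewrite excess_sym. apply excess_sqrt_cap; auto; try lra. split; [|lra];
    eapply node_bound_pos; eauto.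
  + apply excess_cap_cap; auto.
Qed.

(** * Nonnegative monosplines *)

Lemma sum1_0 (f : nat -> R) : sum_n_m f 1 0 = 0 :> R.
Proof. apply (sum_n_m_zero f 1 0). lia. Qed.

Lemma sum1_S (f : nat -> R) N : sum_n_m f 1 (S N) = sum_n_m f 1 N + f (S N) :> R.
Proof. apply (sum_n_Sm f 1 N). lia. Qed.

Lemma sum1_eq0 (f : nat -> R) N :
  (forall i, (1 <= i <= N)%nat -> f i = 0) -> sum_n_m f 1 N = 0 :> R.
Proof.
induction N as [|N IH]; intros H; [apply sum1_0|].
rewrite sum1_S, (H (S N)) by lia. rewrite IH; [apply Rplus_0_l|].
intros i Hi. apply H. lia.
Qed.

(** A quartic with leading coefficient [l / 24], its derivative and a primitive, tied together by
    common coefficients. The interval is closed: adjacent pieces share the three values at their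
    common node, which is how the smoothness of the kernel is used. *)
Definition quartic_on (l : R) (K dK iK : R -> R) (a b : R) : Prop :=
  exists c0 c1 c2 c3 e, forall t, a <= t <= b ->
    K t = l * t ^ 4 / 24 + c3 * t ^ 3 + c2 * t ^ 2 + c1 * t + c0 /\
    dK t = l * t ^ 3 / 6 + 3 * c3 * t ^ 2 + 2 * c2 * t + c1 /\
    iK t = l * t ^ 5 / 120 + c3 * t ^ 4 / 4 + c2 * t ^ 3 / 3 + c1 * t ^ 2 / 2 + c0 * t + e.

Definition potential (n : R) (K dK : R -> R) (t : R) : R :=
  clamp_slope (sqrt (n ^ 4 * K t / 3)) (n ^ 3 * dK t).

(** This is [excess_ge0] for the piece rescaled to length [n * (b - a)]. The outward slope at [a] is
    minus the derivative, and oddness of the clamp turns the sum of the two potentials into a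
    difference, which telescopes. *)
Lemma quartic_piece n K dK iK a b : 0 < n -> a <= b -> quartic_on 1 K dK iK a b ->
  (forall t, a <= t <= b -> 0 <= K t) ->
  0 <= 720 * n ^ 5 * (iK b - iK a) - 5 * n * (b - a) + 4
       + 60 * (potential n K dK b - potential n K dK a).
Proof.
intros Hn Hab (c0 & c1 & c2 & c3 & e & HK) Hpos.
(* An empty piece occurs when 0 or 1 is itself a node; only the constant 4 is left. *)
destruct Hab as [Hab|Hab]; [|subst b; lra].
unfold potential.
assert (Hn4 : 0 < n ^ 4) by (apply pow_lt; lra).
assert (Ka := Hpos a ltac:(lra)). assert (Kb := Hpos b ltac:(lra)).
set (r0 := sqrt (n ^ 4 * K a / 3)). set (r1 := sqrt (n ^ 4 * K b / 3)).
assert (P0 : 0 <= n ^ 4 * K a / 3) by (apply Rmult_le_pos; [apply Rmult_le_pos|]; lra).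
assert (P1 : 0 <= n ^ 4 * K b / 3) by (apply Rmult_le_pos; [apply Rmult_le_pos|]; lra).
assert (R0 : r0 ^ 2 = n ^ 4 * K a / 3) by (unfold r0; apply pow2_sqrt; lra).
assert (R1 : r1 ^ 2 = n ^ 4 * K b / 3) by (unfold r1; apply pow2_sqrt; lra).
assert (Q0 : 0 <= r0) by apply sqrt_pos. assert (Q1 : 0 <= r1) by apply sqrt_pos.
assert (Hh : 0 < n * (b - a)) by (apply Rmult_lt_0_compat; lra).
destruct (HK a ltac:(lra)) as (Ea & Da & Ia). destruct (HK b ltac:(lra)) as (Eb & Db & Ib).
assert (B1 : node_bound (n * (b - a)) r0 (- (n ^ 3 * dK a)) r1 (n ^ 3 * dK b)).
{ intros d Hd. rewrite R0, R1.
  assert (Hx : a <= b - d * (b - a) <= b) by nra.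
  assert (Kx := Hpos _ Hx). destruct (HK _ Hx) as (Ex & _ & _).
  rewrite Ex in Kx. rewrite Ea, Eb, Da, Db.
  (* The right side minus the left side of [node_bound] is a positive multiple of the kernel at the
     test point. *)
  apply Rminus_le_0.
  match type of Kx with 0 <= ?X =>
    replace (_ - _) with (60 * (n * (b - a)) / (d * (1 - d) ^ 2) * (n ^ 4 * X)) by (field; lra) end.
  apply Rmult_le_pos; [|apply Rmult_le_pos; lra].
  apply Rle_mult_inv_pos; [lra|]. apply Rmult_lt_0_compat; [lra|]. apply pow_lt; lra. }
assert (B0 : node_bound (n * (b - a)) r1 (n ^ 3 * dK b) r0 (- (n ^ 3 * dK a))).
{ intros d Hd. rewrite R0, R1.
  assert (Hx : a <= a + d * (b - a) <= b) by nra.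
  assert (Kx := Hpos _ Hx). destruct (HK _ Hx) as (Ex & _ & _).
  rewrite Ex in Kx. rewrite Ea, Eb, Da, Db.
  apply Rminus_le_0.
  match type of Kx with 0 <= ?X =>
    replace (_ - _) with (60 * (n * (b - a)) / (d * (1 - d) ^ 2) * (n ^ 4 * X)) by (field; lra) end.
  apply Rmult_le_pos; [|apply Rmult_le_pos; lra].
  apply Rle_mult_inv_pos; [lra|]. apply Rmult_lt_0_compat; [lra|]. apply pow_lt; lra. }
assert (E := excess_ge0 _ _ _ _ _ Hh Q0 Q1 B1 B0).
rewrite (clamp_slope_opp r0 (n ^ 3 * dK a) Q0) in E.
assert (I : 720 * n ^ 5 * (iK b - iK a) - 5 * n * (b - a) + 4
  = excess (n * (b - a)) r0 (- (n ^ 3 * dK a)) 0 r1 (n ^ 3 * dK b) 0).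
{ unfold excess. rewrite R0, R1, Ea, Eb, Da, Db, Ia, Ib. field. }
unfold excess in E, I. lra.
Qed.

Lemma quartic_on_plus l l' K dK iK K' dK' iK' a b :
  quartic_on l K dK iK a b -> quartic_on l' K' dK' iK' a b ->
  quartic_on (l + l') (fun t => K t + K' t) (fun t => dK t + dK' t) (fun t => iK t + iK' t) a b.
Proof.
intros (c0 & c1 & c2 & c3 & e & H) (c0' & c1' & c2' & c3' & e' & H').
exists (c0 + c0'), (c1 + c1'), (c2 + c2'), (c3 + c3'), (e + e'). intros t Ht.
destruct (H t Ht) as (-> & -> & ->). destruct (H' t Ht) as (-> & -> & ->).
repeat split; field.
Qed.

Definition pospart (x : R) : R := Rmax 0 x.

Lemma pospart_id x : 0 <= x -> pospart x = x.
Proof. apply Rmax_right. Qed.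

Lemma pospart_0 x : x <= 0 -> pospart x = 0.
Proof. apply Rmax_left. Qed.

(** The kernel at [t] is the remainder of the truncated power [(x - t)_+^3 / 6], as
    [peano_remainder] confirms. *)
Definition peano (a tau : nat -> R) (N : nat) (t : R) : R :=
  (1 - t) ^ 4 / 24 + sum_n_m (fun i => - (a i * pospart (tau i - t) ^ 3 / 6)) 1 N.

Definition peano_deriv (a tau : nat -> R) (N : nat) (t : R) : R :=
  - (1 - t) ^ 3 / 6 + sum_n_m (fun i => a i * pospart (tau i - t) ^ 2 / 2) 1 N.

(** For nodes in the unit interval this primitive vanishes at 1, so its negative at 0 is the
    integral of the kernel. *)
Definition peano_prim (a tau : nat -> R) (N : nat) (t : R) : R :=
  - (1 - t) ^ 5 / 120 + sum_n_m (fun i => a i * pospart (tau i - t) ^ 4 / 24) 1 N.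

(** With no node strictly inside the interval, each truncated power is either zero or a full
    polynomial there. *)
Lemma quartic_on_sum (al tau : nat -> R) N a b :
  (forall i, (1 <= i <= N)%nat -> tau i <= a \/ b <= tau i) ->
  quartic_on 0 (fun t => sum_n_m (fun i => - (al i * pospart (tau i - t) ^ 3 / 6)) 1 N)
   (fun t => sum_n_m (fun i => al i * pospart (tau i - t) ^ 2 / 2) 1 N)
   (fun t => sum_n_m (fun i => al i * pospart (tau i - t) ^ 4 / 24) 1 N) a b.
Proof.
induction N as [|N IH]; intros H.
- exists 0, 0, 0, 0, 0. intros t _. rewrite !sum1_0. repeat split; field.
- destruct IH as (c0 & c1 & c2 & c3 & e & IH); [intros i Hi; apply H; lia|].
  destruct (H (S N) ltac:(lia)) as [T|T].
  + exists c0, c1, c2, c3, e. intros t Ht. rewrite !sum1_S.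
    destruct (IH t Ht) as (-> & -> & ->). rewrite pospart_0 by lra. repeat split; field.
  + set (A := al (S N)). set (s := tau (S N)).
    exists (c0 - A * s ^ 3 / 6), (c1 + A * s ^ 2 / 2), (c2 - A * s / 2), (c3 + A / 6),
      (e + A * s ^ 4 / 24).
    intros t Ht. rewrite !sum1_S. fold A s.
    destruct (IH t Ht) as (-> & -> & ->). rewrite pospart_id by (unfold s; lra). repeat split;
      field.
Qed.

Lemma quartic_on_peano al tau N a b :
  (forall i, (1 <= i <= N)%nat -> tau i <= a \/ b <= tau i) ->
  quartic_on 1 (peano al tau N) (peano_deriv al tau N) (peano_prim al tau N) a b.
Proof.
intros H. replace 1 with (1 + 0) at 1 by ring.
apply (quartic_on_plus 1 0 (fun t => (1 - t) ^ 4 / 24) (fun t => - (1 - t) ^ 3 / 6)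
  (fun t => - (1 - t) ^ 5 / 120)).
- exists (1/24), (-1/6), (1/4), (-1/6), (-1/120). intros t _. repeat split; field.
- now apply quartic_on_sum.
Qed.

(** Summing [quartic_piece] over the [N + 1] pieces telescopes the potentials, which vanish at 0 and
    1. With [n = N + 1] this leaves [5 * n - 4 * n = n]. *)
Lemma peano_mean_ge al tau N :
  (forall i, (1 <= i <= N)%nat -> 0 <= tau i <= 1) ->
  (forall i j, (1 <= i)%nat -> (i < j)%nat -> (j <= N)%nat -> tau i < tau j) ->
  peano al tau N 0 = 0 ->
  (forall t, 0 <= t <= 1 -> 0 <= peano al tau N t) ->
  1 / (720 * INR (N + 1) ^ 4) <= - peano_prim al tau N 0.
Proof.
intros HI Hinc HK0 Hpos.
set (n := INR (N + 1)).
assert (Hn : 0 < n) by (apply lt_0_INR; lia).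
(* The partition points: 0, the nodes, and 1 at index [N + 1]. *)
set (s := fun i => match i with O => 0 | S _ => if Nat.leb i N then tau i else 1 end).
assert (Sle : forall i, (i <= N)%nat -> 0 <= s i <= s (S i) /\ s (S i) <= 1 /\
   forall j, (1 <= j <= N)%nat -> tau j <= s i \/ s (S i) <= tau j).
{ intros i Hi. unfold s.
  assert (L : forall j, (1 <= j <= i)%nat -> tau j <= tau i).
  { intros j Hj. destruct (Nat.eq_dec i j) as [->|ne]; [lra|]. left. apply Hinc; lia. }
  assert (U : forall j, (S i <= j <= N)%nat -> tau (S i) <= tau j).
  { intros j Hj. destruct (Nat.eq_dec (S i) j) as [<-|ne]; [lra|]. left. apply Hinc; lia. }
  destruct (Nat.leb_spec (S i) N) as [h1|h1]; destruct i as [|i].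
  - assert (A := HI 1%nat ltac:(lia)). repeat split; try lra. intros j Hj. right. apply U. lia.
  - destruct (Nat.leb_spec (S i) N) as [h2|h2]; [|lia].
    assert (A := HI (S i) ltac:(lia)). assert (B := HI (S (S i)) ltac:(lia)).
    assert (C := Hinc (S i) (S (S i)) ltac:(lia) ltac:(lia) ltac:(lia)).
    repeat split; try lra. intros j Hj.
    destruct (Nat.le_gt_cases j (S i)); [left; apply L; lia | right; apply U; lia].
  - repeat split; try lra. intros j Hj. lia.
  - destruct (Nat.leb_spec (S i) N) as [h2|h2]; [|lia].
    assert (A := HI (S i) ltac:(lia)).
    repeat split; try lra. intros j Hj. left. apply L. lia. }
set (K := peano al tau N) in *. set (dK := peano_deriv al tau N). set (iK := peano_prim al tau N).
assert (T : forall i, (i <= S N)%nat ->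
  0 <= 720 * n ^ 5 * (iK (s i) - iK 0) - 5 * n * s i + 4 * INR i
    + 60 * (potential n K dK (s i) - potential n K dK 0)).
{ induction i as [|i IH]; intros Hi.
  - simpl. lra.
  - specialize (IH ltac:(lia)). destruct (Sle i ltac:(lia)) as (S1 & S2 & S3).
    assert (P := quartic_piece n K dK iK (s i) (s (S i)) Hn (proj2 S1) (quartic_on_peano al tau N
      _ _ S3)).
    assert (Q : 0 <= s i) by lra.
    specialize (P ltac:(intros t Ht; apply Hpos; lra)).
    rewrite S_INR. lra. }
specialize (T (S N) ltac:(lia)).
assert (E : s (S N) = 1) by (unfold s; destruct (Nat.leb_spec (S N) N); [lia | reflexivity]).
rewrite E in T.
assert (K1 : K 1 = 0).
{ unfold K, peano. rewrite sum1_eq0; [field|].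
  intros i Hi. rewrite pospart_0 by (specialize (HI i Hi); lra). field. }
assert (iK1 : iK 1 = 0).
{ unfold iK, peano_prim. rewrite sum1_eq0; [field|].
  intros i Hi. rewrite pospart_0 by (specialize (HI i Hi); lra). field. }
unfold potential in T. rewrite K1, HK0, iK1 in T.
replace (n ^ 4 * 0 / 3) with 0 in T by field. rewrite sqrt_0, !clamp_slope_0 in T.
replace (S N) with (N + 1)%nat in T by lia. fold n in T. 
apply Rmult_le_reg_r with (720 * n ^ 5); [apply Rmult_lt_0_compat; [lra | apply pow_lt; lra]|].
replace (1 / (720 * n ^ 4) * (720 * n ^ 5)) with n by (field; lra). 
fold iK. lra.
Qed.

(** * Kernels of positive definite formulae *)

Lemma derive_D_in f df x : is_derive f x (df x) -> D_in f df I01 x.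
Proof.
intros H. apply is_derive_Reals in H. apply (proj2 (derivable_pt_lim_D_in f df x)) in H.
intros eps He. destruct (H eps He) as (al & Hal & Hl). exists al. split; [exact Hal|].
intros y [[Hy1 Hy2] Hy]. apply Hl. split; [split; [exact I | exact Hy2] | exact Hy].
Qed.

Lemma continuous_continue_in g x : continuous g x -> continue_in g I01 x.
Proof.
intros H. apply continuity_pt_filterlim in H.
intros eps He. destruct (H eps He) as (al & Hal & Hl). exists al. split; [exact Hal|].
intros y [[Hy1 Hy2] Hy]. apply Hl. split; [split; [exact I | exact Hy2] | exact Hy].
Qed.

Lemma C4_01_of_derive f f1 f2 f3 g :
  (forall x, is_derive f x (f1 x)) -> (forall x, is_derive f1 x (f2 x)) ->
  (forall x, is_derive f2 x (f3 x)) -> (forall x, is_derive f3 x (g x)) ->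
  (forall x, continuous g x) -> C4_01 f g.
Proof.
intros H1 H2 H3 H4 Hg. exists f1, f2, f3.
repeat split; intros x Hx; first [apply derive_D_in | apply continuous_continue_in]; auto.
Qed.

Lemma pospart_ge0 x : 0 <= pospart x.
Proof. apply Rmax_l. Qed.

Lemma is_derive_pospart_pow k x : is_derive (fun y => pospart y ^ (S (S k))) x (INR (S (S k)) *
  pospart x ^ S k).
Proof.
destruct (Rtotal_order x 0) as [Hx|[Hx|Hx]].
- apply (is_derive_ext_loc (fun _ => 0)).
  + exists (mkposreal (- x) ltac:(lra)). intros y Hy.
    unfold ball in Hy; simpl in Hy; unfold AbsRing_ball, abs, minus, plus, opp in Hy; simpl in Hy.
    apply Rabs_def2 in Hy. rewrite pospart_0 by lra. rewrite pow_i by lia. reflexivity.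
  + rewrite pospart_0 by lra. rewrite pow_i by lia. rewrite Rmult_0_r. apply @is_derive_const.
- subst x. rewrite pospart_0 by lra. rewrite pow_i by lia. rewrite Rmult_0_r.
  apply is_derive_Reals. intros eps He.
  set (d := Rmin 1 eps). assert (Hd : 0 < d) by (apply Rmin_pos; lra).
  exists (mkposreal d Hd). intros h Hh Hlt. simpl in Hlt.
  rewrite Rplus_0_l, (pospart_0 0), (pow_i (S (S k))), !Rminus_0_r by (lra || lia).
  destruct (Rle_dec h 0).
  + rewrite pospart_0, pow_i by (lra || lia). unfold Rdiv. rewrite Rmult_0_l, Rabs_R0. exact He.
  + rewrite pospart_id by lra. rewrite Rabs_pos_eq in Hlt by lra.
    replace (h ^ S (S k) / h) with (h * h ^ k) by (simpl; field; lra).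
    rewrite Rabs_pos_eq by (apply Rmult_le_pos; [lra | apply pow_le; lra]).
    assert (h < 1) by (eapply Rlt_le_trans; [exact Hlt | apply Rmin_l]).
    assert (h < eps) by (eapply Rlt_le_trans; [exact Hlt | apply Rmin_r]).
    assert (h ^ k <= 1) by (rewrite <- (pow1 k); apply pow_incr; lra).
    assert (0 <= h ^ k) by (apply pow_le; lra). nra.
- apply (is_derive_ext_loc (fun y => y ^ S (S k))).
  + exists (mkposreal x Hx). intros y Hy.
    unfold ball in Hy; simpl in Hy; unfold AbsRing_ball, abs, minus, plus, opp in Hy; simpl in Hy.
    apply Rabs_def2 in Hy. rewrite pospart_id by lra. reflexivity.
  + rewrite pospart_id by lra. apply is_derive_Reals. apply (derivable_pt_lim_pow x (S (S k))).
Qed.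

Lemma is_derive_shift s x : is_derive (fun y : R => y - s) x 1.
Proof.
apply is_derive_Reals. replace 1 with (1 - 0) by ring.
apply (derivable_pt_lim_minus (fun y => y) (fun _ => s)).
- apply derivable_pt_lim_id.
- apply derivable_pt_lim_const.
Qed.

Definition diff2 (eps : R) (F : R -> R) (u : R) : R :=
  (F (u + eps) - 2 * F u + F (u - eps)) / eps ^ 2.

Lemma is_derive_diff2 eps (F dF : R -> R) t (x : R) : (forall y, is_derive F y (dF y)) ->
  is_derive (fun y => diff2 eps F (y - t)) x (diff2 eps dF (x - t)).
Proof.
intros H. unfold diff2, Rdiv.
assert (D : forall s, is_derive (fun y => F (y - s)) x (dF (x - s))).
{ intros s. replace (dF (x - s)) with (scal 1 (dF (x - s))) by apply Rmult_1_l.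
  apply (is_derive_comp F (fun y => y - s)); [apply H | apply is_derive_shift]. }
apply (is_derive_ext (fun y => / eps ^ 2 * ((F (y - (t - eps)) - 2 * F (y - t)) + F (y - (t +
  eps))))).
{ intros y. replace (y - t + eps) with (y - (t - eps)) by ring.
  replace (y - t - eps) with (y - (t + eps)) by ring.
  match goal with |- ?a = ?b => change (@eq R a b) end. ring. }
replace (x - t + eps) with (x - (t - eps)) by ring.
replace (x - t - eps) with (x - (t + eps)) by ring.
rewrite (Rmult_comm _ (/ eps ^ 2)).
apply @is_derive_scal. apply @is_derive_plus; [|apply D].
apply @is_derive_minus; [apply D|]. apply @is_derive_scal. apply D.
Qed.

Lemma continuous_pospart x : continuous pospart x.
Proof.
apply (continuous_ext (fun y => (y + Rabs y) / 2)).
- intros y. unfold pospart, Rmax, Rabs. destruct Rle_dec; destruct Rcase_abs; lra.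
- apply (continuous_mult (fun y => y + Rabs y) (fun _ => / 2)); [|apply continuous_const].
  apply (continuous_plus (fun y => y) Rabs); [apply continuous_id | apply continuous_Rabs].
Qed.

Lemma C4_01_diff2_pospart eps t :
  C4_01 (fun x => diff2 eps (fun y => pospart y ^ 5 / 120) (x - t)) (fun x => diff2 eps pospart
    (x - t)).
Proof.
assert (D : forall k c c', c' = c * INR (S (S k)) -> forall y,
  is_derive (fun y => c * pospart y ^ S (S k)) y (c' * pospart y ^ S k)).
{ intros k c c' -> y. rewrite Rmult_assoc. apply @is_derive_scal. apply is_derive_pospart_pow. }
(* Membership is moved along pointwise equality; only the first derivative condition mentions the
   function itself. *)
assert (E : forall (f f' : R -> R) g, (forall x, f x = f' x) -> C4_01 f' g -> C4_01 f g).
{ intros f f' g H (f1 & f2 & f3 & H1 & H').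
  exists f1, f2, f3. split; [|exact H']. intros x Hx eps' He.
  destruct (H1 x Hx eps' He) as (al & Hal & Hl). exists al. split; [exact Hal|].
  intros y Hy. rewrite !H. now apply Hl. }
apply (E _ (fun x => diff2 eps (fun y => / 120 * pospart y ^ 5) (x - t))).
{ intros x. unfold diff2, Rdiv. match goal with |- ?a = ?b => change (@eq R a b) end. ring. }
apply (C4_01_of_derive _ (fun x => diff2 eps (fun y => / 24 * pospart y ^ 4) (x - t))
 (fun x => diff2 eps (fun y => / 6 * pospart y ^ 3) (x - t))
 (fun x => diff2 eps (fun y => / 2 * pospart y ^ 2) (x - t))).
- intros x. apply (is_derive_diff2 eps _ (fun y => / 24 * pospart y ^ 4)). apply D. simpl. field.
- intros x. apply (is_derive_diff2 eps _ (fun y => / 6 * pospart y ^ 3)). apply D. simpl. field.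
- intros x. apply (is_derive_diff2 eps _ (fun y => / 2 * pospart y ^ 2)). apply D. simpl. field.
- intros x. apply (is_derive_diff2 eps _ pospart). intros y.
  generalize (D 0%nat (/2) 1 ltac:(simpl; field) y). rewrite Rmult_1_l, pow_1. auto.
- intros x. unfold diff2.
  assert (C : forall s, continuous (fun y => pospart (y - t + s)) x).
  { intros s. apply (continuous_comp (fun y => y - t + s) pospart); [|apply continuous_pospart].
    apply (ex_derive_continuous (fun y => y - t + s)). auto_derive. exact I. }
  apply (continuous_ext (fun y => (pospart (y - t + eps) - 2 * pospart (y - t + 0) + pospart (y -
    t + - eps)) * / eps ^ 2)).
  { intros y. rewrite Rplus_0_r. reflexivity. }
  apply (continuous_mult (fun y => pospart (y - t + eps) - 2 * pospart (y - t + 0) + pospart (y -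
    t + - eps)) (fun _ => / eps ^ 2)); [|apply continuous_const].
  apply (continuous_plus (fun y => pospart (y - t + eps) - 2 * pospart (y - t + 0)) (fun y =>
    pospart (y - t + - eps))); [|apply C].
  apply (continuous_minus (fun y => pospart (y - t + eps)) (fun y => 2 * pospart (y - t + 0)));
    [apply C|].
  apply (continuous_mult (fun _ => 2) (fun y => pospart (y - t + 0)));
    [apply continuous_const | apply C].
Qed.

Lemma diff2_pospart_ge0 eps u : 0 < eps -> 0 <= diff2 eps pospart u.
Proof.
intros He. unfold diff2. apply Rle_mult_inv_pos; [|apply pow_lt; lra].
unfold pospart, Rmax. repeat destruct Rle_dec; lra.
Qed.

(** To the right of the kink, for [u >= eps], the error is exactly [u * eps ^ 2 / 12]. Otherwise all
    positive arguments are at most [2 * eps], and every term is of order [eps ^ 3]. *)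
Lemma diff2_pospart5_approx eps u : 0 < eps <= 1 -> u <= 1 ->
  Rabs (diff2 eps (fun y => pospart y ^ 5 / 120) u - pospart u ^ 3 / 6) <= eps ^ 2.
Proof.
intros He Hu. unfold diff2.
assert (He3 : eps ^ 3 <= eps ^ 2) by (assert (0 <= (1 - eps) * eps ^ 2) by (apply Rmult_le_pos;
  [lra | apply pow2_ge_0]); lra).
assert (Hp : forall v, 0 <= v <= 2 * eps -> 0 <= v ^ 5 / 120 / eps ^ 2 <= 32 / 120 * eps ^ 3).
{ intros v Hv. assert (0 <= v ^ 5 <= (2 * eps) ^ 5) by (split; [apply pow_le;
  lra | apply pow_incr; lra]).
  assert (0 < eps ^ 2) by (apply pow_lt; lra). split.
  - apply Rle_mult_inv_pos; lra.
  - apply Rmult_le_reg_r with (eps ^ 2); [lra|]. field_simplify; [|lra]. lra. }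
destruct (Rle_dec eps u).
- rewrite !pospart_id by lra.
  replace (_ - _) with (u * eps ^ 2 / 12) by (field; lra).
  rewrite Rabs_pos_eq; [|apply Rle_mult_inv_pos; [apply Rmult_le_pos; [lra | apply pow2_ge_0]|lra]].
  assert (0 <= (1 - u) * eps ^ 2) by (apply Rmult_le_pos; [lra | apply pow2_ge_0]).
  assert (0 <= eps ^ 2) by apply pow2_ge_0. lra.
- rewrite (pospart_0 (u - eps)) by lra.
  destruct (Rle_dec u 0).
  + rewrite (pospart_0 u) by lra.
    assert (V : 0 <= pospart (u + eps) <= 2 * eps).
    { split; [apply pospart_ge0|]. unfold pospart, Rmax. destruct Rle_dec; lra. }
    specialize (Hp _ V).
    replace (_ - _) with (pospart (u + eps) ^ 5 / 120 / eps ^ 2) by (field; lra).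
    rewrite Rabs_pos_eq by lra. assert (0 <= eps ^ 3) by (apply pow_le; lra). lra.
  + rewrite !pospart_id by lra.
    assert (P1 := Hp (u + eps) ltac:(lra)). assert (P2 := Hp u ltac:(lra)).
    assert (0 <= u ^ 3 <= eps ^ 3) by (split; [apply pow_le; lra | apply pow_incr; lra]).
    assert (0 <= eps ^ 3) by (apply pow_le; lra).
    assert (P3 : u ^ 5 / 120 / eps ^ 2 <= eps ^ 3 / 120).
    { apply Rmult_le_reg_r with (eps ^ 2); [apply pow_lt; lra|]. field_simplify; [|lra].
      assert (u ^ 5 <= eps ^ 5) by (apply pow_incr; lra). lra. }
    replace (_ - _) with ((u + eps) ^ 5 / 120 / eps ^ 2 - 2 * (u ^ 5 / 120 / eps ^ 2) - u ^ 3 /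
      6) by (field; lra).
    apply Rabs_le. lra.
Qed.

Lemma remainder_ge0 Q c f g : positive_definite4 Q c -> C4_01 f g ->
  (forall x, I01 x -> 0 <= g x) -> 0 <= remainder Q f.
Proof.
intros [Hc H] Hf Hg. destruct (H f g Hf) as (xi & Hxi & ->).
apply Rmult_le_pos; [lra | auto].
Qed.

Lemma sum1_scal (c : R) (f g : nat -> R) N : (forall i, (1 <= i <= N)%nat -> f i = c * g i) ->
  sum_n_m f 1 N = c * sum_n_m g 1 N :> R.
Proof.
induction N as [|N IH]; intros H; [rewrite !sum1_0; ring|].
rewrite !sum1_S, (H (S N)) by lia. rewrite IH; [ring|]. intros i Hi. apply H. lia.
Qed.

Lemma sum1_diff_le (f g a : nat -> R) (M : R) N :
  (forall i, (1 <= i <= N)%nat -> Rabs (f i - g i) <= Rabs (a i) * M) ->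
  Rabs (sum_n_m f 1 N - sum_n_m g 1 N) <= sum_n_m (fun i => Rabs (a i)) 1 N * M.
Proof.
induction N as [|N IH]; intros H.
{ rewrite !sum1_0, Rminus_0_r, Rabs_R0. lra. }
rewrite !sum1_S.
replace (_ - _) with ((sum_n_m f 1 N - sum_n_m g 1 N) + (f (S N) - g (S N))) by ring.
eapply Rle_trans; [apply Rabs_triang|]. rewrite Rmult_plus_distr_r.
apply Rplus_le_compat; [apply IH; intros i Hi; apply H; lia | apply H; lia].
Qed.

Lemma RInt_of_derive (F f : R -> R) : (forall x, is_derive F x (f x)) ->
  (forall x, continuous f x) -> RInt f 0 1 = F 1 - F 0.
Proof.
intros HF Hf. apply is_RInt_unique. apply (is_RInt_derive F f); auto.
Qed.

Lemma remainder_pow N Q (a tau : nat -> R) k :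
  (forall f, Q f = sum_n_m (fun i => a i * f (tau i)) 1 N) -> (1 <= k)%nat ->
  remainder Q (fun x => x ^ k / INR (fact k)) =
  1 / INR (fact (S k)) - sum_n_m (fun i => a i * tau i ^ k) 1 N / INR (fact k).
Proof.
intros HQ Hk. unfold remainder. rewrite HQ.
assert (F0 := INR_fact_neq_0 k). assert (F1 := INR_fact_neq_0 (S k)).
rewrite (RInt_of_derive (fun x => x ^ S k / INR (fact (S k)))).
- rewrite pow1, (pow_i (S k)) by lia.
  rewrite (sum1_scal (/ INR (fact k)) _ (fun i => a i * tau i ^ k)); [field; lra|].
  intros i _. field. exact F0.
- intros x. apply is_derive_Reals.
  replace (x ^ k / INR (fact k)) with (/ INR (fact (S k)) * (INR (S k) * x ^ k)).
  + apply (derivable_pt_lim_ext (fun x => / INR (fact (S k)) * x ^ S k)); [intros z; unfold Rdiv;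
    ring|].
    apply (derivable_pt_lim_scal (fun x => x ^ S k)). apply (derivable_pt_lim_pow x (S k)).
  + rewrite fact_simpl, mult_INR. field. split; [exact F0 | apply not_0_INR; lia].
- intros x. apply (continuous_ext (fun y => y ^ k * / INR (fact k))); [reflexivity|].
  apply (continuous_mult (fun y => y ^ k) (fun _ => / INR (fact k))); [|apply continuous_const].
  apply (ex_derive_continuous (fun y => y ^ k)). auto_derive. exact I.
Qed.

Lemma continuous_pospart_cube t x : continuous (fun x => pospart (x - t) ^ 3 / 6) x.
Proof.
apply (ex_derive_continuous (fun x => pospart (x - t) ^ 3 / 6)).
exists (/ 6 * (1 * (INR 3 * pospart (x - t) ^ 2))).
apply (is_derive_ext (fun x => / 6 * pospart (x - t) ^ 3)).
{ intros y. change (@eq R (/ 6 * pospart (y - t) ^ 3) (pospart (y - t) ^ 3 / 6)). field. }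
apply @is_derive_scal. apply (is_derive_comp (fun y => pospart y ^ 3) (fun y => y - t)).
+ apply (is_derive_pospart_pow 1).
+ apply is_derive_shift.
Qed.

Lemma peano_remainder N Q (a tau : nat -> R) t :
  (forall f, Q f = sum_n_m (fun i => a i * f (tau i)) 1 N) -> I01 t ->
  peano a tau N t = remainder Q (fun x => pospart (x - t) ^ 3 / 6).
Proof.
intros HQ Ht. unfold peano, remainder. rewrite HQ.
rewrite (sum1_scal (-1) _ (fun i => a i * (pospart (tau i - t) ^ 3 / 6))) by (intros; field).
rewrite (RInt_of_derive (fun x => / 24 * pospart (x - t) ^ 4)).
- unfold I01 in Ht. rewrite pospart_id, pospart_0 by lra. field.
- intros x. replace (pospart (x - t) ^ 3 / 6) with (/ 24 * (1 * (INR 4 * pospart (x - t) ^ 3)))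
  by (simpl; field).
  apply @is_derive_scal. apply (is_derive_comp (fun y => pospart y ^ 4) (fun y => y - t)).
  + apply (is_derive_pospart_pow 2).
  + apply is_derive_shift.
- intros x. apply continuous_pospart_cube.
Qed.

Lemma continuous_diff2_pospart eps t x :
  continuous (fun x => diff2 eps (fun y => pospart y ^ 5 / 120) (x - t)) x.
Proof.
apply (ex_derive_continuous (fun x => diff2 eps (fun y => pospart y ^ 5 / 120) (x - t))).
exists (diff2 eps (fun y => / 120 * (INR 5 * pospart y ^ 4)) (x - t)).
apply (is_derive_diff2 eps _ (fun y => / 120 * (INR 5 * pospart y ^ 4))). intros y.
apply (is_derive_ext (fun x => / 120 * pospart x ^ 5)).
{ intros z. change (@eq R (/ 120 * pospart z ^ 5) (pospart z ^ 5 / 120)). field. }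
apply @is_derive_scal. apply (is_derive_pospart_pow 3).
Qed.

Lemma ex_RInt_of_continuous (f : R -> R) : (forall x, continuous f x) -> ex_RInt f 0 1.
Proof. intros H. apply (@ex_RInt_continuous R_CompleteNormedModule). auto. Qed.

(* [(x - t)_+^3 / 6] is not C^4; it is approximated by second differences of
   [(x - t)_+^5 / 120], whose fourth derivative is a tent function. *)
Lemma peano_ge0 N Q c (a tau : nat -> R) t :
  (forall i, (1 <= i <= N)%nat -> I01 (tau i)) ->
  (forall f, Q f = sum_n_m (fun i => a i * f (tau i)) 1 N) ->
  positive_definite4 Q c -> I01 t -> 0 <= peano a tau N t.
Proof.
intros HI HQ HP Ht. rewrite (peano_remainder N Q a tau t HQ Ht).
set (A := sum_n_m (fun i => Rabs (a i)) 1 N).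
set (psi := fun x => pospart (x - t) ^ 3 / 6).
assert (H : forall eps, 0 < eps <= 1 -> - ((1 + A) * eps ^ 2) <= remainder Q psi).
{ intros eps He. set (f := fun x => diff2 eps (fun y => pospart y ^ 5 / 120) (x - t)).
  assert (Hf : 0 <= remainder Q f).
  { apply (remainder_ge0 Q c f _ HP (C4_01_diff2_pospart eps t)).
    intros x _. apply diff2_pospart_ge0. lra. }
  assert (Hd : forall x, I01 x -> Rabs (f x - psi x) <= eps ^ 2).
  { intros x Hx. apply diff2_pospart5_approx; unfold I01 in *; lra. }
  assert (If := ex_RInt_of_continuous f (continuous_diff2_pospart eps t)).
  assert (Ip := ex_RInt_of_continuous psi (continuous_pospart_cube t)).
  assert (D1 : Rabs (RInt f 0 1 - RInt psi 0 1) <= eps ^ 2).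
  { change (Rabs (minus (RInt f 0 1) (RInt psi 0 1)) <= eps ^ 2).
    rewrite <- (RInt_minus f psi) by assumption.
    replace (eps ^ 2) with ((1 - 0) * eps ^ 2) by ring.
    apply abs_RInt_le_const; [lra | apply @ex_RInt_minus; assumption | intros x Hx; apply Hd;
      exact Hx]. }
  assert (D2 : Rabs (Q f - Q psi) <= A * eps ^ 2).
  { rewrite !HQ. apply sum1_diff_le. intros i Hi.
    rewrite <- Rmult_minus_distr_l, Rabs_mult.
    apply Rmult_le_compat_l; [apply Rabs_pos | apply Hd, HI, Hi]. }
  unfold remainder in *. apply Rabs_le_between in D1. apply Rabs_le_between in D2. lra. }
destruct (Rle_dec 0 (remainder Q psi)) as [|Hn]; [assumption|]. exfalso.
set (X := - remainder Q psi). assert (HX : 0 < X) by (unfold X; lra).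
assert (HA : 0 <= A).
{ unfold A. clear. induction N as [|n IH]; [rewrite sum1_0; lra|].
  rewrite sum1_S. assert (P := Rabs_pos (a (S n))). lra. }
set (e := Rmin 1 (X / (2 * (1 + A)))).
assert (He : 0 < e <= 1).
{ split; [apply Rmin_pos; [lra | apply Rdiv_lt_0_compat; lra] | apply Rmin_l]. }
assert (He2 : (1 + A) * e <= X / 2).
{ apply Rle_trans with ((1 + A) * (X / (2 * (1 + A)))).
  - apply Rmult_le_compat_l; [lra | apply Rmin_r].
  - right. field. lra. }
specialize (H e He). assert ((1 + A) * e ^ 2 <= (1 + A) * e) by (apply Rmult_le_compat_l;
  [lra | nra]).
unfold X in *. lra.
Qed.

Lemma C4_01_pow3 : C4_01 (fun x => x ^ 3 / INR (fact 3)) (fun _ => 0).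
Proof.
apply (C4_01_of_derive _ (fun x => x ^ 2 / 2) (fun x => x) (fun _ => 1));
  intros x; try (simpl; auto_derive; [exact I | field]).
apply continuous_const.
Qed.

Lemma C4_01_pow4 : C4_01 (fun x => x ^ 4 / INR (fact 4)) (fun _ => 1).
Proof.
apply (C4_01_of_derive _ (fun x => x ^ 3 / 6) (fun x => x ^ 2 / 2) (fun x => x));
  intros x; try (simpl; auto_derive; [exact I | field]).
apply continuous_const.
Qed.

(** Testing with [x ^ 3 / 6] shows that the kernel vanishes at 0, and testing with [x ^ 4 / 24] that
    [c] is its integral; [peano_mean_ge] then applies. *)
Lemma positive_definite4_lower_bound N Q c : quadrature N Q -> positive_definite4 Q c ->
  1 / (720 * INR (N + 1) ^ 4) <= c.
Proof.
intros (a & tau & HI & Hinc & HQ) HP.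
assert (E3 : remainder Q (fun x => x ^ 3 / INR (fact 3)) = 0).
{ destruct (proj2 HP _ _ C4_01_pow3) as (xi & _ & ->). ring. }
assert (E4 : remainder Q (fun x => x ^ 4 / INR (fact 4)) = c).
{ destruct (proj2 HP _ _ C4_01_pow4) as (xi & _ & ->). ring. }
rewrite (remainder_pow N Q a tau 3 HQ) in E3 by lia.
rewrite (remainder_pow N Q a tau 4 HQ) in E4 by lia.
assert (F3 : INR (fact 3) = 6) by (simpl; ring).
assert (F4 : INR (fact 4) = 24) by (simpl; ring).
assert (F5 : INR (fact 5) = 120) by (simpl; ring).
rewrite F3, F4 in E3. rewrite F4, F5 in E4.
replace c with (- peano_prim a tau N 0).
- apply peano_mean_ge; auto.
  + unfold peano. rewrite (sum1_scal (-1/6) _ (fun i => a i * tau i ^ 3)); [lra|].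
    intros i Hi. rewrite Rminus_0_r, pospart_id by (apply HI; exact Hi). field.
  + intros t Ht. apply (peano_ge0 N Q c a tau); auto.
- unfold peano_prim. rewrite (sum1_scal (1/24) _ (fun i => a i * tau i ^ 4)); [lra|].
  intros i Hi. rewrite Rminus_0_r, pospart_id by (apply HI; exact Hi). field.
Qed.

(** * Extension to the real line *)

(** Retraction onto the unit interval. Composition with it turns relative continuity into continuity
    on the whole line. *)
Definition clamp01 (x : R) : R := Rmax 0 (Rmin 1 x).

Lemma clamp01_in x : I01 (clamp01 x).
Proof. unfold I01, clamp01, Rmax, Rmin. repeat destruct Rle_dec; lra. Qed.

Lemma clamp01_id x : I01 x -> clamp01 x = x.
Proof. unfold I01, clamp01, Rmax, Rmin. repeat destruct Rle_dec; lra. Qed.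

Lemma clamp01_lipschitz x y : Rabs (clamp01 y - clamp01 x) <= Rabs (y - x).
Proof.
unfold clamp01, Rmax, Rmin. repeat destruct Rle_dec; unfold Rabs; repeat destruct Rcase_abs; lra.
Qed.

Lemma continuous_clamp01 g : (forall x, I01 x -> continue_in g I01 x) ->
  forall x, continuous (fun y => g (clamp01 y)) x.
Proof.
intros H x. apply continuity_pt_filterlim. intros eps He.
destruct (H _ (clamp01_in x) eps He) as (al & Hal & Hl). exists al. split; [exact Hal|].
intros y [_ Hy]. simpl in *. unfold Rdist in *.
destruct (Req_dec (clamp01 y) (clamp01 x)) as [->|ne].
- rewrite Rminus_diag, Rabs_R0. exact He.
- apply Hl. split; [split; [apply clamp01_in | auto]|].
  eapply Rle_lt_trans; [apply clamp01_lipschitz | exact Hy].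
Qed.

Lemma is_derive_clamp01 f df x : 0 < x < 1 -> D_in f df I01 x ->
  is_derive (fun y => f (clamp01 y)) x (df x).
Proof.
intros Hx H. apply is_derive_Reals. intros eps He.
destruct (H eps He) as (al & Hal & Hl).
assert (Hd : 0 < Rmin al (Rmin x (1 - x))) by (repeat apply Rmin_pos; lra).
exists (mkposreal _ Hd). intros h Hh Hlt. simpl in Hlt.
assert (L1 := Rlt_le_trans _ _ _ Hlt (Rmin_l _ _)).
assert (L2 := Rlt_le_trans _ _ _ Hlt (Rmin_r _ _)).
assert (L3 := Rlt_le_trans _ _ _ L2 (Rmin_l _ _)).
assert (L4 := Rlt_le_trans _ _ _ L2 (Rmin_r _ _)).
apply Rabs_def2 in L3. apply Rabs_def2 in L4.
rewrite !clamp01_id by (unfold I01; lra).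
specialize (Hl (x + h)). simpl in Hl. unfold Rdist in Hl.
replace (x + h - x) with h in Hl by ring. apply Hl.
split; [split; [unfold I01; lra | lra] | exact L1].
Qed.

(** The mean value theorem needs derivatives only at interior points and continuity up to the ends,
    so one-sided data at 0 and 1 suffice. *)
Lemma D_in_eq_on f df F dF :
  (forall x, I01 x -> D_in f df I01 x) -> (forall x, is_derive F x (dF x)) ->
  (forall x, I01 x -> df x = dF x) -> f 0 = F 0 -> forall x, I01 x -> f x = F x.
Proof.
intros Hf HF E E0 x Hx.
destruct (MVT_gen (fun y => f (clamp01 y) - F y) 0 x (fun _ => 0)) as (c & _ & Hc).
- intros y Hy. rewrite Rmin_left, Rmax_right in Hy by (unfold I01 in Hx; lra).
  unfold I01 in Hx.
  replace 0 with (df y - dF y) by (rewrite E by (unfold I01; lra); ring).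
  apply @is_derive_minus; [apply is_derive_clamp01; [lra | apply Hf; unfold I01; lra] | apply HF].
- intros y _. apply continuity_pt_filterlim.
  apply (continuous_minus (fun y => f (clamp01 y)) F).
  + apply continuous_clamp01. intros z Hz. eapply cont_deriv. apply Hf, Hz.
  + apply ex_derive_continuous. exists (dF y). apply HF.
- rewrite (clamp01_id 0), (clamp01_id x) in Hc by (auto; unfold I01; lra). lra.
Qed.

Definition prim (c : R) (g : R -> R) (x : R) : R := c + RInt g 0 x.

Lemma prim_0 c g : prim c g 0 = c.
Proof. unfold prim. rewrite RInt_point. apply Rplus_0_r. Qed.

Lemma is_derive_prim c (g : R -> R) (x : R) : (forall y, continuous g y) ->
  is_derive (prim c g) x (g x).
Proof.
intros Hg. unfold prim. rewrite <- (Rplus_0_l (g x)).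
apply @is_derive_plus; [apply @is_derive_const|].
apply (is_derive_RInt g (fun y => RInt g 0 y) 0 x); [|apply Hg].
exists (mkposreal 1 Rlt_0_1). intros y _.
apply (@RInt_correct R_CompleteNormedModule).
apply (@ex_RInt_continuous R_CompleteNormedModule). intros z _. apply Hg.
Qed.

Lemma continuous_prim c (g : R -> R) (x : R) : (forall y, continuous g y) ->
  continuous (prim c g) x.
Proof. intros Hg. apply (ex_derive_continuous (prim c g)). exists (g x). apply is_derive_prim,
  Hg. Qed.

(* [A] plays the role of a primitive of the integrand [F]. *)
Definition C5 (A F F1 F2 F3 G : R -> R) : Prop :=
  (forall x, is_derive A x (F x)) /\ (forall x, is_derive F x (F1 x)) /\
  (forall x, is_derive F1 x (F2 x)) /\ (forall x, is_derive F2 x (F3 x)) /\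
  (forall x, is_derive F3 x (G x)).

(** Extend [g] by constants and integrate four times, starting from the derivatives of [f] at 0; one
    more integration gives [A]. *)
Lemma C4_01_extend f g : C4_01 f g -> exists A F F1 F2 F3 G,
  C5 A F F1 F2 F3 G /\ (forall x, continuous G x) /\
  (forall x, I01 x -> f x = F x) /\ (forall x, I01 x -> g x = G x).
Proof.
intros (f1 & f2 & f3 & H1 & H2 & H3 & H4 & H5).
set (G := fun x => g (clamp01 x)).
set (F3 := prim (f3 0) G). set (F2 := prim (f2 0) F3). set (F1 := prim (f1 0) F2).
set (F := prim (f 0) F1).
assert (CG : forall x, continuous G x) by (apply continuous_clamp01, H5).
assert (C3 : forall x, continuous F3 x) by (intros; apply continuous_prim, CG).
assert (C2 : forall x, continuous F2 x) by (intros; apply continuous_prim, C3).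
assert (C1 : forall x, continuous F1 x) by (intros; apply continuous_prim, C2).
assert (C0 : forall x, continuous F x) by (intros; apply continuous_prim, C1).
assert (EG : forall x, I01 x -> g x = G x) by (intros x Hx; unfold G; now rewrite clamp01_id).
assert (E3 : forall x, I01 x -> f3 x = F3 x).
{ apply (D_in_eq_on f3 g F3 G); auto; [intros; now apply is_derive_prim | symmetry; apply prim_0]. }
assert (E2 : forall x, I01 x -> f2 x = F2 x).
{ apply (D_in_eq_on f2 f3 F2 F3); auto; [intros; now apply is_derive_prim | symmetry;
  apply prim_0]. }
assert (E1 : forall x, I01 x -> f1 x = F1 x).
{ apply (D_in_eq_on f1 f2 F1 F2); auto; [intros; now apply is_derive_prim | symmetry;
  apply prim_0]. }
assert (E0 : forall x, I01 x -> f x = F x).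
{ apply (D_in_eq_on f f1 F F1); auto; [intros; now apply is_derive_prim | symmetry; apply prim_0]. }
exists (prim 0 F), F, F1, F2, F3, G.
repeat split; auto; intros; now apply is_derive_prim.
Qed.

(** * The explicit formula *)

(* Integration by parts against [p] with [p'''' = 1]: the derivative of
   [A + J] is [p G]. *)
Lemma peano_step A F F1 F2 F3 G s c0 c1 c2 c3 a b m : C5 A F F1 F2 F3 G -> a <= b ->
  let p := fun x => let u := x - s in u ^ 4 / 24 + c3 * u ^ 3 + c2 * u ^ 2 + c1 * u + c0 in
  let P := fun x => let u := x - s in
    u ^ 5 / 120 + c3 * u ^ 4 / 4 + c2 * u ^ 3 / 3 + c1 * u ^ 2 / 2 + c0 * u in
  let J := fun x => let u := x - s in
    p x * F3 x - (u ^ 3 / 6 + 3 * c3 * u ^ 2 + 2 * c2 * u + c1) * F2 x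
    + (u ^ 2 / 2 + 6 * c3 * u + 2 * c2) * F1 x - (u + 6 * c3) * F x in
  (forall x, a <= x <= b -> 0 <= p x) -> (forall x, a <= x <= b -> m <= G x) ->
  m * (P b - P a) <= A b - A a + J b - J a.
Proof.
intros (HA & H0 & H1 & H2 & H3) Hab p P J Hp Hm.
set (H := fun x => A x + J x - m * P x).
assert (HD : forall x, is_derive H x (p x * (G x - m))).
{ intros x. unfold H, J, P, p. auto_derive.
  - repeat split; try exact I; [exists (F x) | exists (G x) | exists (F3 x) | exists (F2 x) |
    exists (F1 x)]; auto.
  - assert (D : forall f df : R -> R, (forall y, is_derive f y (df y)) ->
    Derive (fun y : R => f y) x = df x)
      by (intros f df Hf; apply is_derive_unique, Hf).
    rewrite (D _ _ HA), (D _ _ H0), (D _ _ H1), (D _ _ H2), (D _ _ H3).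
    field. }
destruct (MVT_gen H a b (fun x => p x * (G x - m))) as (c & Hc & E).
- intros x _. apply HD.
- intros x _. apply continuity_pt_filterlim. apply (ex_derive_continuous H). eexists. apply HD.
- rewrite Rmin_left, Rmax_right in Hc by lra.
  assert (0 <= p c * (G c - m) * (b - a)).
  { apply Rmult_le_pos; [apply Rmult_le_pos|]; [now apply Hp | specialize (Hm c Hc); lra | lra]. }
  unfold H in E. lra.
Qed.

(** The kernel [u ^ 2 * (h - u) ^ 2 / 24] and its derivative vanish at both ends, so only [F] and
    [F1] survive: the trapezoidal rule with its first Euler-Maclaurin correction. *)
Lemma cell_bound A F F1 F2 F3 G a h m : C5 A F F1 F2 F3 G -> 0 < h ->
  (forall x, a <= x <= a + h -> m <= G x) ->
  m * (h ^ 5 / 720) <= A (a + h) - A a + h ^ 2 / 12 * (F1 (a + h) - F1 a) - h / 2 * (F a + F (a +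
    h)).
Proof.
intros HC Hh Hm.
assert (B := peano_step A F F1 F2 F3 G a 0 0 (h ^ 2 / 24) (- h / 12) a (a + h) m HC ltac:(lra)).
simpl in B. refine (Rle_trans _ _ _ _ (Rle_trans _ _ _ (B _ Hm) _)).
- right. field.
- intros x Hx. match goal with |- 0 <= ?X => replace X with ((x - a) ^ 2 * (h - (x - a)) ^ 2 /
  24) by field end.
  apply Rle_mult_inv_pos; [|lra]. apply Rmult_le_pos; apply pow2_ge_0.
- right. field.
Qed.

(** The kernel starts as [u ^ 4 / 24 + 5 * h * u ^ 3 / 72], and a node [x] of weight [w * h]
    subtracts [w * h * (u - x) ^ 3 / 6] beyond it. From the middle of the cell on it coincides with
    the inner kernel. Its second derivative is zero at [a], so [F1 a] does not occur. *)
Lemma end_cell_bound A F F1 F2 F3 G a h m : C5 A F F1 F2 F3 G -> 0 < h ->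
  (forall x, a <= x <= a + h -> m <= G x) ->
  m * (h ^ 5 / 720 - h ^ 5 / 10368) <= A (a + h) - A a + h ^ 2 / 12 * F1 (a + h) - h / 2 * F (a + h)
    - h * (- (5 / 12) * F a + 3 / 2 * F (a + h / 6) - 3 / 4 * F (a + h / 3) + 1 / 6 * F (a + h /
      2)).
Proof.
intros HC Hh Hm.
assert (B0 := peano_step A F F1 F2 F3 G a 0 0 0 (5 * h / 72) a (a + h / 6) m HC ltac:(lra)).
assert (B1 := peano_step A F F1 F2 F3 G a (h ^ 4 / 864) (- h ^ 3 / 48) (h ^ 2 / 8) (5 * h / 72 -
  h / 4) (a + h / 6) (a + h / 3) m HC ltac:(lra)).
assert (B2 := peano_step A F F1 F2 F3 G a (h ^ 4 / 864 - h ^ 4 / 216) (- h ^ 3 / 48 + h ^ 3 / 24)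
  (h ^ 2 / 8 - h ^ 2 / 8) (5 * h / 72 - h / 4 + h / 8) (a + h / 3) (a + h / 2) m HC ltac:(lra)).
assert (B3 := peano_step A F F1 F2 F3 G a 0 0 (h ^ 2 / 24) (- h / 12) (a + h / 2) (a + h) m HC
  ltac:(lra)).
simpl in B0, B1, B2, B3.
assert (M : forall b c, a <= b -> c <= a + h -> forall x, b <= x <= c ->
  m <= G x) by (intros b c Hb Hc x Hx; apply Hm; lra).
(* The shifted cube is compared with [u ^ 3]: [u - h / 6] is at most [u / 2] up to [h / 3], and at
   most [2 * u / 3] up to [h / 2]. *)
assert (C : forall v w k, 0 <= v -> v <= k * w -> 0 <= w -> v ^ 3 <= k ^ 3 * w ^ 3).
{ intros v w k Hv Hvw Hw. rewrite <- Rpow_mult_distr. apply pow_incr. lra. }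
assert (P0 := fun H => B0 H (M a (a + h / 6) ltac:(lra) ltac:(lra))).
assert (P1 := fun H => B1 H (M (a + h / 6) (a + h / 3) ltac:(lra) ltac:(lra))).
assert (P2 := fun H => B2 H (M (a + h / 3) (a + h / 2) ltac:(lra) ltac:(lra))).
assert (P3 := fun H => B3 H (M (a + h / 2) (a + h) ltac:(lra) ltac:(lra))).
clear B0 B1 B2 B3.
match type of P0 with ?X -> _ => assert (Q0 : X) end.
{ intros x Hx. assert (0 <= (x - a) ^ 4) by (apply pow_le; lra).
  assert (0 <= h * (x - a) ^ 3) by (apply Rmult_le_pos; [lra | apply pow_le; lra]). lra. }
match type of P1 with ?X -> _ => assert (Q1 : X) end.
{ intros x Hx. set (u := x - a). assert (Hu : h / 6 <= u <= h / 3) by (unfold u; lra).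
  assert (0 <= u ^ 4) by (apply pow_le; lra). assert (U : 0 <= h * u ^ 3) by (apply Rmult_le_pos;
    [lra | apply pow_le; lra]).
  assert (C1 := C (u - h / 6) u (1/2) ltac:(lra) ltac:(lra) ltac:(lra)).
  assert (C2 := Rmult_le_compat_l _ _ _ (Rlt_le _ _ Hh) C1). lra. }
match type of P2 with ?X -> _ => assert (Q2 : X) end.
{ intros x Hx. set (u := x - a). assert (Hu : h / 3 <= u <= h / 2) by (unfold u; lra).
  assert (V : h / 3 * u ^ 3 <= u ^ 4).
  { replace (u ^ 4) with (u * u ^ 3) by ring. apply Rmult_le_compat_r; [apply pow_le; lra | lra]. }
  assert (U : 0 <= h * u ^ 3) by (apply Rmult_le_pos; [lra | apply pow_le; lra]).
  assert (W : 0 <= h * (u - h / 3) ^ 3) by (apply Rmult_le_pos; [lra | apply pow_le; lra]).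
  assert (C1 := C (u - h / 6) u (2/3) ltac:(lra) ltac:(lra) ltac:(lra)).
  assert (C2 := Rmult_le_compat_l _ _ _ (Rlt_le _ _ Hh) C1). lra. }
match type of P3 with ?X -> _ => assert (Q3 : X) end.
{ intros x Hx. match goal with |- 0 <= ?X => replace X with ((x - a) ^ 2 * (h - (x - a)) ^ 2 /
  24) by field end.
  apply Rle_mult_inv_pos; [|lra]. apply Rmult_le_pos; apply pow2_ge_0. }
specialize (P0 Q0). specialize (P1 Q1). specialize (P2 Q2). specialize (P3 Q3). lra.
Qed.

Lemma C5_opp A F F1 F2 F3 G : C5 A F F1 F2 F3 G ->
  C5 (fun x => - A x) (fun x => - F x) (fun x => - F1 x) (fun x => - F2 x) (fun x => - F3 x) (fun
    x => - G x).
Proof.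
intros (HA & H0 & H1 & H2 & H3).
refine (conj _ (conj _ (conj _ (conj _ _)))); intros x; apply @is_derive_opp; auto.
Qed.

Lemma is_derive_reflect (f df : R -> R) x : (forall y, is_derive f y (df y)) ->
  is_derive (fun y => f (1 - y)) x (- df (1 - x)).
Proof.
intros H. replace (- df (1 - x)) with (scal (-1) (df (1 - x))) by (unfold scal; simpl;
  unfold mult; simpl; ring).
apply (is_derive_comp f (fun y => 1 - y)); [apply H|].
apply is_derive_Reals. replace (-1) with (0 - 1) by ring.
apply (derivable_pt_lim_minus (fun _ => 1) (fun y => y));
  [apply derivable_pt_lim_const | apply derivable_pt_lim_id].
Qed.

Lemma is_derive_reflect_opp (f df : R -> R) x : (forall y, is_derive f y (df y)) ->
  is_derive (fun y => - f (1 - y)) x (df (1 - x)).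
Proof.
intros H. rewrite <- (Ropp_involutive (df (1 - x))).
apply @is_derive_opp. now apply is_derive_reflect.
Qed.

Lemma C5_reflect A F F1 F2 F3 G : C5 A F F1 F2 F3 G ->
  C5 (fun x => - A (1 - x)) (fun x => F (1 - x)) (fun x => - F1 (1 - x))
     (fun x => F2 (1 - x)) (fun x => - F3 (1 - x)) (fun x => G (1 - x)).
Proof.
intros (HA & H0 & H1 & H2 & H3).
refine (conj _ (conj _ (conj _ (conj _ _)))); intros x;
  (apply is_derive_reflect || apply is_derive_reflect_opp); auto.
Qed.

(** Over consecutive cells the [F1] corrections telescope, and the trapezoidal sums combine into the
    full sum less half of the two end values. *)
Lemma inner_cells_bound A F F1 F2 F3 G h m j : C5 A F F1 F2 F3 G -> 0 < h ->
  (forall x, h <= x <= INR (S j) * h -> m <= G x) ->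
  m * (INR j * h ^ 5 / 720) <= A (INR (S j) * h) - A h + h ^ 2 / 12 * (F1 (INR (S j) * h) - F1 h)
    - h * sum_n_m (fun k => F (INR k * h)) 1 (S j) + h / 2 * (F h + F (INR (S j) * h)).
Proof.
intros HC Hh. induction j as [|j IH]; intros Hm.
- rewrite sum1_S, sum1_0. simpl INR. rewrite !Rmult_1_l. lra.
- rewrite sum1_S.
  assert (Hj : 0 <= INR j) by apply pos_INR.
  rewrite !S_INR in *.
  assert (B := cell_bound A F F1 F2 F3 G ((INR j + 1) * h) h m HC Hh).
  replace ((INR j + 1) * h + h) with ((INR j + 1 + 1) * h) in B by ring.
  assert (J : 0 <= INR j * h) by (apply Rmult_le_pos; lra).
  specialize (B ltac:(intros x Hx; apply Hm; lra)).
  specialize (IH ltac:(intros x Hx; apply Hm; lra)). lra.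
Qed.

Definition error_const (n : nat) : R := 1 / (720 * INR n ^ 4) * (1 - 5 / (36 * INR n)).

(** Two end cells and [n - 2] inner cells; their [F1] terms cancel at [h] and [1 - h]. The factor
    [1 - 5 / (36 * n)] comes from the two end deficits [h ^ 5 / 10368]. *)
Lemma Qn7_bound n A F F1 F2 F3 G m : (2 <= n)%nat -> C5 A F F1 F2 F3 G ->
  (forall x, I01 x -> m <= G x) ->
  m * error_const n <= A 1 - A 0 - Qn7 n F.
Proof.
intros Hn HC Hm. destruct n as [|[|j]]; try lia. clear Hn.
set (n := S (S j)). set (h := / INR n).
assert (Nn : INR n = INR j + 2) by (unfold n; rewrite !S_INR; ring).
assert (Hj : 0 <= INR j) by apply pos_INR.
assert (Hh : 0 < h) by (apply Rinv_0_lt_compat; lra).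
assert (HNh : INR n * h = 1) by (unfold h; field; lra).
assert (Hh1 : h <= 1 / 2) by (rewrite Nn in HNh; nra).
assert (Ej : INR (S j) * h = 1 - h) by (rewrite S_INR; rewrite Nn in HNh; lra).
assert (BL := end_cell_bound A F F1 F2 F3 G 0 h m HC Hh ltac:(intros x Hx; apply Hm; unfold I01;
  lra)).
(* The right end cell is the left one after the reflection of the interval. *)
assert (BR := end_cell_bound _ _ _ _ _ _ 0 h m (C5_reflect _ _ _ _ _ _ HC) Hh
  ltac:(intros x Hx; apply Hm; unfold I01; lra)).
assert (BI := inner_cells_bound A F F1 F2 F3 G h m j HC Hh
  ltac:(intros x Hx; apply Hm; unfold I01; lra)).
rewrite Ej in BI. simpl in BR. rewrite !Rplus_0_l in *. rewrite Rminus_0_r in BR.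
assert (EQ : Qn7 n F = h * (- (5 / 12) * (F 0 + F 1) + 3 / 2 * (F (h / 6) + F (1 - h / 6))
   - 3 / 4 * (F (h / 3) + F (1 - h / 3)) + 1 / 6 * (F (h / 2) + F (1 - h / 2)))
   + h * sum_n_m (fun k => F (INR k * h)) 1 (S j)).
{ unfold Qn7, Defs.sigma. replace (n - 1)%nat with (S j) by (unfold n; lia).
  rewrite Rminus_0_r.
  replace (1 / (6 * INR n)) with (h / 6) by (unfold h; field; lra).
  replace (1 / (3 * INR n)) with (h / 3) by (unfold h; field; lra).
  replace (1 / (2 * INR n)) with (h / 2) by (unfold h; field; lra).
  change (fun k => F (INR k / INR n)) with (fun k => F (INR k * h)).
  unfold h; field; lra. }
assert (EC : error_const n = (INR j + 2) * h ^ 5 / 720 - 2 * (h ^ 5 / 10368)).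
{ unfold error_const, h. rewrite Nn. field. lra. }
rewrite EQ, EC. lra.
Qed.

Lemma between_values g lo hi y : (forall x, continuous g x) -> I01 lo -> I01 hi ->
  g lo <= y <= g hi -> exists xi, I01 xi /\ g xi = y.
Proof.
intros Hg Hlo Hhi Hy.
destruct (IVT_gen g lo hi y) as (xi & Hxi & E).
- intros x. apply continuity_pt_filterlim, Hg.
- rewrite Rmin_left, Rmax_right by lra. exact Hy.
- exists xi. split; [|exact E]. unfold I01, Rmin, Rmax in *. destruct Rle_dec; lra.
Qed.

Lemma error_const_pos n : (2 <= n)%nat -> 0 < error_const n.
Proof.
intros Hn. assert (2 <= INR n) by (apply (le_INR 2 n Hn)).
unfold error_const. apply Rmult_lt_0_compat.
- apply Rdiv_lt_0_compat; [lra|]. apply Rmult_lt_0_compat; [lra | apply pow_lt; lra].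
- apply Rlt_0_minus. apply Rmult_lt_reg_r with (36 * INR n); [lra|].
  field_simplify; lra.
Qed.

Lemma Qn7_ext n f F : (2 <= n)%nat -> (forall x, I01 x -> f x = F x) -> Qn7 n f = Qn7 n F.
Proof.
intros Hn E. assert (2 <= INR n) by (apply (le_INR 2 n Hn)).
assert (L : forall k, 2 <= k -> 0 <= 1 / (k * INR n) <= 1).
{ intros k Hk. split; [apply Rle_mult_inv_pos; nra|].
  apply Rmult_le_reg_r with (k * INR n); [nra|]. field_simplify; nra. }
assert (S : forall x, 0 <= x <= 1 -> Defs.sigma f x = Defs.sigma F x).
{ intros x Hx. unfold Defs.sigma. rewrite !E by (unfold I01; lra). reflexivity. }
unfold Qn7. rewrite !S by (lra || apply L; lra).
do 2 f_equal. apply sum_n_m_ext_loc. intros k Hk. apply E.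
unfold I01. assert (1 <= INR k) by (apply (le_INR 1);
  lia). assert (INR k <= INR n) by (apply le_INR; lia).
split; [apply Rle_mult_inv_pos; lra|]. apply Rmult_le_reg_r with (INR n); [lra|]. field_simplify;
  lra.
Qed.

Lemma Qn7_opp n F : Qn7 n (fun x => - F x) = - Qn7 n F.
Proof.
unfold Qn7, Defs.sigma. rewrite (sum1_scal (-1) _ (fun k => F (INR k / INR n))) by (intros; ring).
lra.
Qed.

Lemma Qn7_positive_definite n : (2 <= n)%nat -> positive_definite4 (Qn7 n) (error_const n).
Proof.
intros Hn. assert (Hc := error_const_pos n Hn). split; [exact Hc|].
intros f g Hfg. destruct (C4_01_extend f g Hfg) as (A & F & F1 & F2 & F3 & G & HC & CG & Ef & Eg).
assert (ER : remainder (Qn7 n) f = A 1 - A 0 - Qn7 n F).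
{ unfold remainder. rewrite (Qn7_ext n f F Hn Ef). f_equal.
  rewrite (RInt_ext f F).
  - destruct HC as (HA & H0 & _). apply RInt_of_derive; [exact HA|].
    intros x. apply (ex_derive_continuous F). eexists. apply H0.
  - intros x Hx. rewrite Rmin_left, Rmax_right in Hx by lra. apply Ef. unfold I01; lra. }
assert (CP : forall x, 0 <= x <= 1 ->
  continuity_pt G x) by (intros; apply continuity_pt_filterlim, CG).
destruct (continuity_ab_min G 0 1 ltac:(lra) CP) as (lo & Hlo & Ilo).
destruct (continuity_ab_maj G 0 1 ltac:(lra) CP) as (hi & Hhi & Ihi).
assert (B1 := Qn7_bound n A F F1 F2 F3 G (G lo) Hn HC Hlo).
(* The upper estimate is the lower one for the negated function. *)
assert (B2 := Qn7_bound n _ _ _ _ _ _ (- G hi) Hn (C5_opp _ _ _ _ _ _ HC)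
  ltac:(intros x Hx; apply Ropp_le_contravar, Hhi, Hx)).
rewrite Qn7_opp in B2.
destruct (between_values G lo hi ((A 1 - A 0 - Qn7 n F) / error_const n) CG Ilo Ihi) as (xi & Hxi
  & E).
- split; (apply Rmult_le_reg_r with (error_const n); [lra|]; unfold Rdiv;
  rewrite ?Rmult_assoc, ?Rinv_l by lra; lra).
- exists xi. split; [exact Hxi|]. rewrite ER, Eg, E by exact Hxi. field. lra.
Qed.

(** * Ordered nodes and weights of the explicit formula *)

(* Nodes are numbered from 1; the value at index 0 is irrelevant. *)
Definition Qn7_node (n i : nat) : R :=
  match i with
  | 0 | 1 => 0 | 2 => 1 / (6 * INR n) | 3 => 1 / (3 * INR n) | 4 => 1 / (2 * INR n)
  | _ => if (i <=? n + 3)%nat then INR (i - 4) / INR n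
         else match (i - n)%nat with
              | 4 => 1 - 1 / (2 * INR n) | 5 => 1 - 1 / (3 * INR n) | 6 => 1 - 1 / (6 * INR n)
              | _ => 1 end
  end.

Definition Qn7_weight (n i : nat) : R :=
  match i with
  | 0 | 1 => - (5 / (12 * INR n)) | 2 => 3 / (2 * INR n) | 3 => - (3 / (4 * INR n)) | 4 => 1 / (6
    * INR n)
  | _ => if (i <=? n + 3)%nat then 1 / INR n
         else match (i - n)%nat with
              | 4 => 1 / (6 * INR n) | 5 => - (3 / (4 * INR n)) | 6 => 3 / (2 * INR n)
              | _ => - (5 / (12 * INR n)) end
  end.

Lemma Qn7_node_mid n k : (1 <= k <= n - 1)%nat ->
  Qn7_node n (k + 4) = INR k / INR n /\ Qn7_weight n (k + 4) = 1 / INR n.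
Proof.
intros Hk. destruct k as [|k]; [lia|].
replace (S k + 4)%nat with (5 + k)%nat by lia. unfold Qn7_node, Qn7_weight.
cbv beta iota delta [Nat.add]. fold Nat.add.
assert (L : (S (S (S (S (S k)))) <=? n + 3)%nat = true) by (apply Nat.leb_le; lia).
rewrite L. replace (S (S (S (S (S k)))) - 4)%nat with (S k) by lia. auto.
Qed.

Lemma Qn7_node_end n k : (1 <= n)%nat ->
  Qn7_node n (n + 4 + k) = match k with O => 1 - 1 / (2 * INR n) | S O => 1 - 1 / (3 * INR n)
    | S (S O) => 1 - 1 / (6 * INR n) | _ => 1 end /\
  Qn7_weight n (n + 4 + k) = match k with O => 1 / (6 * INR n) | S O => - (3 / (4 * INR n))
    | S (S O) => 3 / (2 * INR n) | _ => - (5 / (12 * INR n)) end.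
Proof.
intros Hn.
(* The index is at least 5, so the match on small literals falls through to its last branch. *)
assert (E : exists p, (n + 4 + k = S (S (S (S (S p)))))%nat) by (exists (n + k - 1)%nat; lia).
destruct E as (p & E).
assert (L : (S (S (S (S (S p)))) <=? n + 3)%nat = false) by (apply Nat.leb_gt; lia).
rewrite E. unfold Qn7_node, Qn7_weight. rewrite L, <- E.
replace (n + 4 + k - n)%nat with (4 + k)%nat by lia. cbn [Nat.add].
destruct k as [|[|[|k]]]; auto.
Qed.

Lemma sum1_shift4 (f : nat -> R) p :
  sum_n_m f 1 (p + 4) = f 1%nat + f 2%nat + f 3%nat + f 4%nat + sum_n_m (fun k => f (k + 4)%nat)
    1 p :> R.
Proof.
induction p as [|p IH].
- simpl. rewrite !sum1_S, !sum1_0. ring.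
- rewrite (sum1_S _ p). simpl (S p + 4)%nat. rewrite sum1_S, IH. ring.
Qed.

Lemma increasing_of_step (tau : nat -> R) N :
  (forall i, (1 <= i)%nat -> (i < N)%nat -> tau i < tau (S i)) ->
  forall i j, (1 <= i)%nat -> (i < j)%nat -> (j <= N)%nat -> tau i < tau j.
Proof.
intros H i j Hi Hij HN. induction Hij as [|j Hij IH]; [apply H; lia|].
apply Rlt_trans with (tau j); [apply IH; lia | apply H; lia].
Qed.

Lemma Qn7_node_step n i : (2 <= n)%nat -> (1 <= i)%nat -> (i < n + 7)%nat ->
  Qn7_node n i < Qn7_node n (S i).
Proof.
intros Hn Hi Hi2.
assert (H2 : 2 <= INR n) by (apply (le_INR 2 n Hn)).
set (u := / INR n). assert (Hu : 0 < u) by (apply Rinv_0_lt_compat; lra).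
assert (Eu : INR n * u = 1) by (unfold u; field; lra).
assert (D : forall k, k <> 0 -> 1 / (k * INR n) = u / k) by (intros k Hk; unfold u; field; lra).
destruct (Nat.le_gt_cases i 4) as [L|L].
- assert (N5 := proj1 (Qn7_node_mid n 1 ltac:(lia))). simpl (1 + 4)%nat in N5.
  destruct i as [|[|[|[|[|i]]]]]; try lia.
  + unfold Qn7_node. rewrite D by lra. lra.
  + unfold Qn7_node. rewrite !D by lra. lra.
  + unfold Qn7_node. rewrite !D by lra. lra.
  + rewrite N5. unfold Qn7_node. rewrite !D by lra. simpl INR. unfold Rdiv. fold u. lra.
- destruct (Nat.le_gt_cases i (n + 3)) as [L2|L2].
  + replace i with (i - 4 + 4)%nat by lia.
    rewrite (proj1 (Qn7_node_mid n (i - 4) ltac:(lia))).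
    destruct (Nat.eq_dec i (n + 3)) as [->|ne].
    * replace (S (n + 3 - 4 + 4)) with (n + 4 + 0)%nat by lia.
      rewrite (proj1 (Qn7_node_end n 0 ltac:(lia))), D by lra.
      replace (n + 3 - 4)%nat with (n - 1)%nat by lia. rewrite minus_INR by lia. 
      unfold Rdiv. fold u. simpl (INR 1). rewrite Rmult_minus_distr_r, Eu. lra.
    * replace (S (i - 4 + 4)) with (S (i - 4) + 4)%nat by lia.
      rewrite (proj1 (Qn7_node_mid n (S (i - 4)) ltac:(lia))).
      rewrite S_INR. apply Rmult_lt_compat_r; [exact Hu | lra].
  + assert (E : exists k, (k < 3)%nat /\ i = (n + 4 + k)%nat) by (exists (i - (n + 4))%nat; lia).
    destruct E as (k & Hk & ->). replace (S (n + 4 + k)) with (n + 4 + S k)%nat by lia.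
    rewrite (proj1 (Qn7_node_end n k ltac:(lia))), (proj1 (Qn7_node_end n (S k) ltac:(lia))).
    destruct k as [|[|[|k]]]; rewrite ?D by lra; (lra || lia).
Qed.

Lemma Qn7_quadrature n : (2 <= n)%nat -> quadrature (n + 7) (Qn7 n).
Proof.
intros Hn. exists (Qn7_weight n), (Qn7_node n).
assert (Hinc := increasing_of_step (Qn7_node n) (n + 7) (fun i Hi Hi2 => Qn7_node_step n i Hn Hi
  Hi2)).
assert (E0 : Qn7_node n 1 = 0) by reflexivity.
assert (E1 : Qn7_node n (n + 7) = 1).
{ replace (n + 7)%nat with (n + 4 + 3)%nat by lia. apply Qn7_node_end. lia. }
split; [|split; [exact Hinc|]].
- intros i Hi. split.
  + destruct (Nat.eq_dec i 1) as [->|ne]; [lra|]. rewrite <- E0. left. apply Hinc; lia.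
  + destruct (Nat.eq_dec i (n + 7)) as [->|ne]; [lra|]. rewrite <- E1. left. apply Hinc; lia.
- intros f.
  assert (H2 : 2 <= INR n) by (apply (le_INR 2 n Hn)).
  replace (n + 7)%nat with (S (S (S (S (n - 1 + 4))))) by lia.
  rewrite !sum1_S, sum1_shift4.
  replace (S (n - 1 + 4)) with (n + 4 + 0)%nat by lia.
  replace (S (n + 4 + 0)) with (n + 4 + 1)%nat by lia.
  replace (S (n + 4 + 1)) with (n + 4 + 2)%nat by lia.
  replace (S (n + 4 + 2)) with (n + 4 + 3)%nat by lia.
  rewrite (sum1_scal (1 / INR n) _ (fun k => f (INR k / INR n))).
  + destruct (Qn7_node_end n 0 ltac:(lia)) as [->
    ->]. destruct (Qn7_node_end n 1 ltac:(lia)) as [-> ->].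
    destruct (Qn7_node_end n 2 ltac:(lia)) as [->
      ->]. destruct (Qn7_node_end n 3 ltac:(lia)) as [-> ->].
    unfold Qn7, Defs.sigma, Qn7_node, Qn7_weight. rewrite Rminus_0_r. ring.
  + intros k Hk. destruct (Qn7_node_mid n k Hk) as [-> ->]. reflexivity.
Qed.

(** * Asymptotic optimality *)

Lemma c_plus4_bounds n : (2 <= n)%nat ->
  1 / (720 * INR (n + 8) ^ 4) <= c_plus4 (n + 7) <= error_const n.
Proof.
intros Hn. unfold c_plus4.
set (E := fun c => exists Q, quadrature (n + 7) Q /\ positive_definite4 Q c).
destruct (Glb_Rbar_correct E) as [Hlb Hglb].
assert (U : Rbar_le (Glb_Rbar E) (error_const n)).
{ apply Hlb. exists (Qn7 n). split; [now apply Qn7_quadrature | now apply Qn7_positive_definite]. }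
assert (L : Rbar_le (1 / (720 * INR (n + 8) ^ 4)) (Glb_Rbar E)).
{ apply Hglb. intros c (Q & HQ & HP). simpl.
  replace (n + 8)%nat with (n + 7 + 1)%nat
    by lia. now apply (positive_definite4_lower_bound (n + 7) Q). }
(* Finite bounds on both sides exclude the infinite values, so [real] returns the true infimum. *)
destruct (Glb_Rbar E) as [x| |]; simpl in *; tauto.
Qed.

(** The ratio is squeezed between 1, as the formula itself competes in the infimum, and
    [((n + 8) / n) ^ 4], from the lower bound for [n + 7] nodes. *)
Lemma error_const_ratio_lim : is_lim_seq (fun n => error_const n / c_plus4 (n + 7)) 1.
Proof.
apply (is_lim_seq_le_le_loc (fun _ => 1) _ (fun n => (1 + 8 * / INR n) ^ 4)).
- exists 2%nat. intros n Hn.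
  assert (H2 : 2 <= INR n) by (apply (le_INR 2 n Hn)).
  assert (Hc := error_const_pos n Hn). destruct (c_plus4_bounds n Hn) as [L U].
  assert (H8 : INR (n + 8) = INR n + 8) by (rewrite plus_INR; simpl; ring). rewrite H8 in L.
  assert (P : 0 < (INR n + 8) ^ 4) by (apply pow_lt; lra).
  assert (P' : 0 < INR n ^ 4) by (apply pow_lt; lra).
  assert (L0 : 0 < 1 / (720 * (INR n + 8) ^ 4)) by (apply Rdiv_lt_0_compat; lra).
  split; (apply Rmult_le_reg_r with (c_plus4 (n + 7)); [lra|]); unfold Rdiv at 1;
    rewrite ?Rmult_assoc, ?Rinv_l by lra; [lra|].
  rewrite Rmult_1_r.
  apply Rle_trans with ((1 + 8 * / INR n) ^ 4 * (1 / (720 * (INR n + 8) ^ 4))).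
  + replace ((1 + 8 * / INR n) ^ 4 * (1 / (720 * (INR n + 8) ^ 4))) with (1 / (720 * INR n ^ 4) * 1)
      by (field; split; lra).
    unfold error_const.
    apply Rmult_le_compat_l; [apply Rle_mult_inv_pos; lra|].
    assert (0 <= 5 / (36 * INR n)) by (apply Rle_mult_inv_pos; lra). lra.
  + apply Rmult_le_compat_l; [apply pow_le | exact L].
    assert (0 < / INR n) by (apply Rinv_0_lt_compat; lra). lra.
- apply is_lim_seq_const.
- replace (Finite 1) with (Finite ((1 + 8 * 0) ^ 4)) by (f_equal; ring).
  apply (is_lim_seq_continuous (fun x => (1 + 8 * x) ^ 4) (fun n => / INR n)).
  + apply derivable_continuous_pt. reg.
  + apply (is_lim_seq_inv INR p_infty); [apply is_lim_seq_INR | discriminate].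
Qed.

Theorem mainTheorem9 :
  (forall n : nat, (2 <= n)%nat ->
     quadrature (n + 7) (Qn7 n) /\
     positive_definite4 (Qn7 n)
       (1 / (720 * INR n ^ 4) * (1 - 5 / (36 * INR n)))) /\
  asymptotically_optimal4 (fun n => (n + 7)%nat) Qn7.
Proof.
assert (H : forall n : nat, (2 <= n)%nat ->
  quadrature (n + 7) (Qn7 n) /\ positive_definite4 (Qn7 n) (error_const n))
  by (intros n Hn; split; [now apply Qn7_quadrature | now apply Qn7_positive_definite]).
split; [exact H|].
exists error_const. split; [exists 2%nat; exact H | exact error_const_ratio_lim].
Qed.
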